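(* Fix $\lambda\in(0,1]$ and a symmetric finitely supported probability measure $\mu$ on $\mathbb R$. Let $D$ be an infinite set of positive integers $d$ such that $m=d/\lambda$ is an integer and such that there is a monic polynomial $p_d$ of degree $d$ with real nonnegative roots satisfying $\mu_{\mathbb{S}p_d}=\mu$. Then, as $d\to\infty$ along $D$, $\mathcal{R}^{d,\lambda}_{\mathbb{S}p_d}(s)\to \mathcal{R}^{\lambda}_{\mu}(s)$, both coefficientwise and pointwise for all $s$ small enough.
   Context: For $p$ monic of degree $d$ with roots $\rho_1,\dots,\rho_d\ge0$, $\mathbb{S}p(x)=p(x^2)$ and $\mu_{\mathbb{S}p}=\frac{1}{2d}\sum_{i=1}^d(\delta_{\sqrt{\rho_i}}+\delta_{-\sqrt{\rho_i}})$. Finite rectangular $R$-transform (with $m=d/\lambda$): writing $p(x)=\sum_{i=0}^d(-1)^ip_ix^{d-i}$ and $E_p(s):=\sum_{i=0}^d (-1)^i (md)^i\frac{(m-i)!(d-i)!}{m!\,d!}p_i s^i$, $\mathcal{R}^{d,\lambda}_{\mathbb{S}p}(s)$ is the unique polynomial of degree at most $d$ agreeing with $-\frac{s}{d}\frac{d}{ds}\log E_p(s)$ modulo $s^{d+1}$. Free rectangular $R$-transform (Benaych-Georges): for a compactly supported symmetric measure $\mu$, $\mathcal G_\mu(x)=\int\frac{d\mu(t)}{x-t}$; $H^\lambda_\mu(x)=\lambda\,\mathcal G_\mu(1/\sqrt x)^2+(1-\lambda)\sqrt x\,\mathcal G_\mu(1/\sqrt x)=x+O(x^2)$ is analytic near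 $0$ with compositional inverse $[H^\lambda_\mu]^{-1}$ analytic near $0$; $U^\lambda(x)=\frac{-\lambda-1+((\lambda+1)^2+4\lambda x)^{1/2}}{2\lambda}$; and $\mathcal R^\lambda_\mu(x)=U^\lambda\!\left(\frac{x}{[H^\lambda_\mu]^{-1}(x)}-1\right)$, analytic near $0$. *)

(* Defs.v *)
From HB Require Import structures.
From mathcomp Require Import all_boot all_order all_algebra.
From mathcomp Require Import all_classical all_reals all_analysis.
Set Implicit Arguments. Unset Strict Implicit. Unset Printing Implicit Defensive.
Import Order.TTheory GRing.Theory Num.Theory.
Import numFieldNormedType.Exports.
Local Open Scope ring_scope.

Section Defs.
Variable R : realType.

(* A finitely supported measure  mu = sum_{x in xs} w x * delta_x  :
   its mass at the point x. *)
Definition dmass (xs : seq R) (w : R -> R) (x : R) : R :=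
  if x \in xs then w x else 0.

(* Mass at x of mu_{S p} = 1/(2d) sum_i (delta_{sqrt rho_i} + delta_{-sqrt rho_i}),
   where rho = [rho_1; ...; rho_d] are the roots of p (with multiplicity). *)
Definition muS_mass (rho : seq R) (x : R) : R :=
  ((2 * size rho)%:R)^-1 *
  \sum_(r <- rho) ((Num.sqrt r == x)%:R + (- Num.sqrt r == x)%:R).

Definition poly_of_roots (rho : seq R) : {poly R} :=
  \prod_(r <- rho) ('X - r%:P).

(* p(x) = sum_i (-1)^i p_i x^(d-i) ;  p_i = (-1)^i [x^(d-i)] p. *)
Definition pcoef (rho : seq R) (i : nat) : R :=
  (-1) ^+ i * (poly_of_roots rho)`_(size rho - i).

Definition Epoly (m : nat) (rho : seq R) : {poly R} :=
  let d := size rho in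
  \poly_(i < d.+1)
    ((-1) ^+ i * ((m * d)%:R) ^+ i *
     (((m - i)`! * (d - i)`!)%:R / ((m`! * d`!)%:R)) * pcoef rho i).

(* First n coefficients of the formal power series inverse 1/a
   (a`_0 <> 0): b_0 = 1/a_0, b_n = -(1/a_0) sum_{j=1}^n a_j b_{n-j}. *)
Fixpoint pinv_seq (a : {poly R}) (n : nat) : seq R :=
  if n is n'.+1 then
    let b := pinv_seq a n' in
    rcons b ((a`_0)^-1 * ((n' == 0%N)%:R - \sum_(1 <= j < n'.+1) a`_j * b`_(n' - j)))
  else [::].

(* Finite rectangular R-transform R^{d,lambda}_{S p}, m = d/lambda:
   the polynomial of degree <= d agreeing with
   -(s/d) d/ds log E_p(s) = -(1/d) s E_p'(s) / E_p(s)  modulo s^(d+1). *)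
Definition finR (m : nat) (rho : seq R) : {poly R} :=
  let d := size rho in
  let E := Epoly m rho in
  let b := pinv_seq E d.+1 in
  let N := 'X * E^`() in
  \poly_(k < d.+1) (- (d%:R)^-1 * \sum_(j < k.+1) N`_j * b`_(k - j)).

Definition Gmu (xs : seq R) (w : R -> R) (z : R) : R :=
  \sum_(x <- xs) w x / (z - x).

Definition Hmu (lam : R) (xs : seq R) (w : R -> R) (y : R) : R :=
  lam * (Gmu xs w ((Num.sqrt y)^-1)) ^+ 2
  + (1 - lam) * Num.sqrt y * Gmu xs w ((Num.sqrt y)^-1).

Definition Ufun (lam x : R) : R :=
  (- lam - 1 + Num.sqrt ((lam + 1) ^+ 2 + 4 * lam * x)) / (2 * lam).

End Defs.

(* Main.v *)
Require Import Defs.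
From HB Require Import structures.
From mathcomp Require Import all_boot all_order all_algebra.
From mathcomp Require Import all_classical all_reals all_analysis.
From mathcomp Require Import ring lra.
Import Order.TTheory GRing.Theory Num.Theory.
Import numFieldNormedType.Exports.
Local Open Scope ring_scope.
Set Implicit Arguments. Unset Strict Implicit. Unset Printing Implicit Defensive.

(* Write F(s) = prod_i (1 - rho_i s) = sum_n F_n s^n, so that E_n = c_n F_n with
   c_n = (md)^n (m-n)! (d-n)! / (m! d!), and let theta = s d/ds.  Multiplication by
   s on F becomes on E the operator X = s (1 - theta/m)^-1 (1 - theta/d)^-1.  For
   a root rho put Z_rho = (rho X / (1 - rho X)) E / E.  Then
   u = -(1/d) theta E / E is the mu-average of the Z_{x^2}, and conjugating theta by
   E turns the relation between X and theta into
     (1 + u - (theta-1)/d) (1 + lam u - lam (theta-1)/d) Z_rho = rho s (1 + Z_rho)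
   up to order d.  This is a recursion for the coefficients.  Because
   c_i c_j <= c_{i+j-1}, the rescaled coefficients |Z_n| / c_n satisfy a cubic
   majorant recursion that does not depend on d, hence grow geometrically; and
   c_n <= e^(2n).  Letting d -> oo coefficientwise, dominated convergence gives
   series with (1 + r)(1 + lam r) zeta_x = x^2 s (1 + zeta_x), that is
   r(s) = psi(t) with s = t (1 + psi(t)) (1 + lam psi(t)) = H(t), where
   psi(t) = int x^2 t / (1 - x^2 t) dmu(x).  Injectivity of H near 0 then
   identifies r(H(y)) = psi(y) = U(H(y)/y - 1). *)

(** * Convolution of sequences *)

Section Convolution.
Variable R : comNzRingType.
Implicit Types a b c : nat -> R.

Definition cconv a b n := \sum_(i < n.+1) a i * b (n - i)%N.
Definition delta0 n : R := (n == 0%N)%:R.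

Lemma eq_cconv a a' b b' n :
  (forall i, (i <= n)%N -> a i = a' i) -> (forall i, (i <= n)%N -> b i = b' i) ->
  cconv a b n = cconv a' b' n.
Proof.
move=> aE bE; apply: eq_bigr => i _; rewrite aE ?bE ?leq_subr //.
by rewrite -ltnS.
Qed.

(** Coefficient [n] of a product involves only indices up to [n], so truncation to polynomials
    transfers the ring laws of [{poly R}] to convolution. *)
Lemma cconv_polyE N a b n : (n < N)%N ->
  cconv a b n = (\poly_(i < N) a i * \poly_(i < N) b i)`_n.
Proof.
move=> nN; rewrite coefM; apply: eq_bigr => i _; rewrite !coef_poly.
rewrite (leq_ltn_trans _ nN) ?(leq_ltn_trans (leq_subr i n) nN) //.
by rewrite -ltnS.
Qed.

Lemma cconvC a b n : cconv a b n = cconv b a n.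
Proof. by rewrite !(@cconv_polyE n.+1) // mulrC. Qed.

Lemma cconvA a b c n : cconv a (cconv b c) n = cconv (cconv a b) c n.
Proof.
pose p a := \poly_(i < n.+1) a i.
have pE x y i : (i <= n)%N -> cconv x y i = (p x * p y)`_i.
  by move=> ?; rewrite (@cconv_polyE n.+1).
have xE x i : (i <= n)%N -> x i = (p x)`_i by move=> lein; rewrite coef_poly ltnS lein.
transitivity ((p a * (p b * p c))`_n).
  by rewrite coefM; apply: eq_cconv => i lein; [exact: xE | exact: pE].
by rewrite mulrA coefM; apply: eq_cconv => i lein; symmetry; [exact: pE | exact: xE].
Qed.

Lemma cconvDr a b c n : cconv a (fun i => b i + c i) n = cconv a b n + cconv a c n.
Proof. by rewrite /cconv -big_split; apply: eq_bigr => i _; rewrite mulrDr. Qed.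

Lemma cconvDl a b c n : cconv (fun i => a i + b i) c n = cconv a c n + cconv b c n.
Proof. by rewrite cconvC cconvDr !(cconvC c). Qed.

Lemma cconvZr k a b n : cconv a (fun i => k * b i) n = k * cconv a b n.
Proof. by rewrite /cconv mulr_sumr; apply: eq_bigr => i _; rewrite mulrCA. Qed.

Lemma cconvZl k a b n : cconv (fun i => k * a i) b n = k * cconv a b n.
Proof. by rewrite cconvC cconvZr cconvC. Qed.

Lemma cconv_suml (I : Type) (s : seq I) (a : I -> nat -> R) b n :
  cconv (fun i => \sum_(x <- s) a x i) b n = \sum_(x <- s) cconv (a x) b n.
Proof.
by rewrite /cconv exchange_big; apply: eq_bigr => i _; rewrite mulr_suml.
Qed.

Lemma cconv_delta0l a n : cconv delta0 a n = a n.
Proof.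
rewrite /cconv big_ord_recl big1 ?addr0 /delta0 /= ?mul1r ?subn0 // => i _.
by rewrite mul0r.
Qed.

Lemma cconv_delta0r a n : cconv a delta0 n = a n.
Proof. by rewrite cconvC cconv_delta0l. Qed.

(** Leibniz rule for theta = s d/ds, which multiplies coefficient [n] by [n]. *)
Lemma cconv_euler a b n :
  n%:R * cconv a b n =
  cconv (fun i => i%:R * a i) b n + cconv a (fun i => i%:R * b i) n.
Proof.
rewrite /cconv mulr_sumr -big_split; apply: eq_bigr => -[i /= lein] _.
have -> : n%:R = i%:R + (n - i)%:R :> R by rewrite -natrD subnKC.
by ring.
Qed.

(** Multiplication by the variable s, on coefficients. *)
Definition sshift a n := if n is n'.+1 then a n' else 0 : R.

Lemma cconv_sshift a b n : cconv (sshift a) b n = sshift (cconv a b) n.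
Proof.
by case: n => [|n]; rewrite /cconv big_ord_recl /= mul0r add0r ?big_ord0.
Qed.

End Convolution.

Arguments delta0 {R}.

(** * The reciprocal of a power series *)

Section PowerSeriesInverse.
Variables (R : realType) (a : {poly R}).

(** An entry of [pinv_seq] never changes as the list grows, so each coefficient can be read off the
    shortest list that contains it. *)
Definition pinv_coef n := (pinv_seq a n.+1)`_n.

Lemma size_pinv_seq n : size (pinv_seq a n) = n.
Proof. by elim: n => //= n IH; rewrite size_rcons IH. Qed.

Lemma nth_pinv_seq n i : (i < n)%N -> (pinv_seq a n)`_i = pinv_coef i.
Proof.
elim: n => // n IH; rewrite ltnS leq_eqVlt => /orP[/eqP -> //|ltin].
by rewrite /= nth_rcons size_pinv_seq ltin IH.
Qed.

Lemma pinv_coefE n : pinv_coef n =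
  (a`_0)^-1 * (delta0 n - \sum_(i < n) a`_i.+1 * pinv_coef (n - i.+1)).
Proof.
rewrite /pinv_coef /= nth_rcons size_pinv_seq ltnn eqxx /delta0.
congr (_ * (_ - _)); rewrite big_add1 /= big_mkord; apply: eq_bigr => i _.
by rewrite nth_pinv_seq // -subn_gt0 subKn.
Qed.

Lemma cconv_pinv n : a`_0 != 0 -> cconv (fun i => a`_i) pinv_coef n = delta0 n.
Proof.
move=> a0; rewrite /cconv big_ord_recl subn0 pinv_coefE mulVKf //=.
by rewrite subrK.
Qed.

End PowerSeriesInverse.

(** * The reversed polynomial of p and its logarithmic derivative *)

Section ReversedPolynomial.
Variable R : realType.
Implicit Types rho : seq R.

(** This is s^d p(1/s), the series F of the overview; its coefficient of s^i is (-1)^i p_i. *)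
Definition revpoly rho : {poly R} := \prod_(r <- rho) (1 - r *: 'X).

Lemma size_revpoly rho : (size (revpoly rho) <= (size rho).+1)%N.
Proof.
elim: rho => [|r rho IH]; rewrite /revpoly ?big_nil ?size_poly1 // big_cons.
apply: leq_trans (size_polyMleq _ _) _; rewrite -/(revpoly rho).
have s2 : (size (1 - r *: 'X : {poly R})%R <= 2)%N.
  apply: leq_trans (size_polyD _ _) _; rewrite size_poly1 geq_max /=.
  by rewrite size_polyN; apply: leq_trans (size_scale_leq _ _) _; rewrite size_polyX.
by rewrite -subn1 leq_subLR; apply: leq_trans (leq_add s2 IH) _.
Qed.

Lemma poly_of_roots_rev rho i : (i <= size rho)%N ->
  (poly_of_roots rho)`_(size rho - i) = (revpoly rho)`_i.
Proof.
elim: rho i => [|r rho IH] i; rewrite /poly_of_roots /revpoly.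
  by rewrite leqn0 !big_nil => /eqP ->.
rewrite !big_cons -/(poly_of_roots _) -/(revpoly _) !mulrBl coefB mul1r coefB.
rewrite -scalerAl coefZ !coefXM mul_polyC coefZ /=.
have sp : size (poly_of_roots rho) = (size rho).+1 by rewrite size_prod_XsubC.
case: i => [|i].
  rewrite subn0 /= -[X in (_ X - _) = _](subn0 (size rho)) IH //.
  by rewrite (nth_default 0 (s := poly_of_roots rho)) ?sp.
rewrite ltnS subSS /= => lei; rewrite IH //; congr (_ - _).
move: lei; rewrite leq_eqVlt => /orP[/eqP->|lti].
  by rewrite subnn eqxx nth_default ?size_revpoly.
by rewrite subn_eq0 leqNgt lti /= -subnS IH.
Qed.

Lemma revpoly_rem r rho : r \in rho ->
  revpoly rho = (1 - r *: 'X) * revpoly (rem r rho).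
Proof. by move=> rrho; rewrite /revpoly (perm_big _ (perm_to_rem rrho)) big_cons. Qed.

Lemma deriv_revpoly rho :
  (revpoly rho)^`() = - \sum_(r <- rho) r *: revpoly (rem r rho).
Proof.
elim: rho => [|r0 rho IH]; first by rewrite /revpoly !big_nil derivC oppr0.
rewrite [revpoly]lock {1}/revpoly -lock big_cons -/(revpoly rho) derivM IH.
rewrite derivB derivC derivZ derivX sub0r big_cons /= eqxx mulrN mulNr opprD.
congr (_ + _); first by rewrite -scalerAl mul1r.
rewrite mulr_sumr; congr (- _); apply: eq_big_seq => r rrho.
(* When [r] equals the head [r0], [rem] deletes the head and leaves [rho] whole; the factor
   [1 - r0 *: 'X] then restores the copy of [r] removed from [rho]. *)
rewrite -scalerAr; congr (_ *: _); case: eqP => [->|_]; first by rewrite -revpoly_rem.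
by rewrite /revpoly big_cons.
Qed.

End ReversedPolynomial.

(** * The recursion at finite d *)

Section RectangularRecursion.
Variable R : realType.
Implicit Types (m d n k : nat) (rho : seq R) (r : R).

(** The weights c_n of the overview. *)
Definition rect_weight m d n : R :=
  (m * d)%:R ^+ n * (((m - n)`! * (d - n)`!)%:R / (m`! * d`!)%:R).

Lemma rect_weight0 m d : rect_weight m d 0 = 1.
Proof.
by rewrite /rect_weight expr0 !subn0 mul1r divff // pnatr_eq0 muln_eq0 !gtn_eqF ?fact_gt0.
Qed.

(** The ratio c_(n+1)/c_n is md/((d-n)(m-n)); this is the coefficient form of X = s (1 - theta/m)^-1
    (1 - theta/d)^-1. *)
Lemma rect_weightS m d n : (n < d)%N -> (n < m)%N ->
  (1 - n%:R / d%:R) * (1 - n%:R / m%:R) * rect_weight m d n.+1 = rect_weight m d n.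
Proof.
move=> nd nm; rewrite /rect_weight exprS -(subnSK nd) -(subnSK nm) !factS.
rewrite (subnSK nd) (subnSK nm) !natrM !natrB ?(ltnW nd) ?(ltnW nm) //.
field; rewrite !pnatr_eq0 -!lt0n !fact_gt0 (leq_ltn_trans _ nd) //.
by rewrite (leq_ltn_trans _ nm).
Qed.

Lemma coef_Epoly m rho i : (i <= size rho)%N ->
  (Epoly m rho)`_i = rect_weight m (size rho) i * (revpoly rho)`_i.
Proof.
move=> ile; rewrite coef_poly ltnS ile /pcoef poly_of_roots_rev // /rect_weight.
have s2 : (-1) ^+ i * (-1) ^+ i = 1 :> R by rewrite -expr2 sqrr_sign.
rewrite -[RHS]mul1r -[X in _ = X * _]s2; move: ((-1) ^+ i) (_ / _) => s c; ring.
Qed.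

Lemma Epoly0 m rho : (Epoly m rho)`_0 = 1.
Proof.
rewrite coef_Epoly // rect_weight0 mul1r.
elim: rho => [|r rho IH]; rewrite /revpoly ?big_nil ?coef1 // big_cons.
rewrite -/(revpoly _) mulrBl mul1r -scalerAl coefB coefZ coefXM mulr0 subr0.
exact: IH.
Qed.

(** The hypothesis is theta e = - d u e, so Leibniz gives theta (Y e) = (theta Y - d u Y) e:
    conjugating 1 - (theta - 1) h by e adds the multiplication by h d u. *)
Lemma conj_euler (u e Y : nat -> R) (d h : R) n :
  (forall k, k%:R * e k = - d * cconv u e k) ->
  (1 - (n%:R - 1) * h) * cconv Y e n =
  cconv (fun k => (1 - (k%:R - 1) * h) * Y k + h * d * cconv u Y k) e n.
Proof.
move=> uE.
transitivity (cconv (fun k => (1 + h) * Y k + ((- h) * (k%:R * Y k) + h * d * cconv u Y k)) e n);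
  last by apply: eq_cconv => // i _; ring.
rewrite !cconvDl !cconvZl.
have -> : cconv (cconv u Y) e n = cconv Y (cconv u e) n.
  by rewrite cconvA; apply: eq_cconv => // i _; rewrite cconvC.
have := cconv_euler Y e n.
have -> : cconv Y (fun i => i%:R * e i) n = - d * cconv Y (cconv u e) n.
  by rewrite -cconvZr; apply: eq_cconv => // i _; rewrite uE.
set a := cconv (fun i => i%:R * Y i) e n; set b := cconv Y (cconv u e) n; set c := cconv Y e n => nE.
have -> : a = n%:R * c + d * b by rewrite nE; ring.
by ring.
Qed.

(** The full power series u = -(1/d) theta E / E, of which [finR] is the truncation at degree d;
    without the cut, multiplying back by E is exact at every index. *)
Definition finR_seq m rho : nat -> R := fun n =>
  - (size rho)%:R^-1 *
  cconv (fun k => k%:R * (Epoly m rho)`_k) (pinv_coef (Epoly m rho)) n.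

(* The resolvent series Z_r = r t / (1 - r t) of the free functional equation,
   before the limit d -> oo: the weights are applied to r s F / (1 - r s), with
   F = prod (1 - r s), and the result is divided by E. *)
Definition resolvent_seq m rho r : nat -> R :=
  cconv (fun k => rect_weight m (size rho) k * (r *: ('X * revpoly (rem r rho)))`_k)
       (pinv_coef (Epoly m rho)).

Lemma coef_finR m rho k : (k <= size rho)%N -> (finR m rho)`_k = finR_seq m rho k.
Proof.
move=> kd; rewrite coef_poly ltnS kd /finR_seq /cconv; congr (_ * _).
apply: eq_bigr => -[j jk] _; rewrite [Ordinal jk : nat]/=; rewrite nth_pinv_seq; last first.
  by rewrite ltnS (leq_trans (leq_subr _ _)).
congr (_ * _); rewrite coefXM coef_deriv.
by case: j jk => [|j] _ /=; rewrite ?mul0r // mulr_natl.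
Qed.

Lemma finR_seq0 m rho : finR_seq m rho 0 = 0.
Proof. by rewrite /finR_seq /cconv big_ord1 !mul0r mulr0. Qed.

Lemma resolvent_seq0 m rho r : resolvent_seq m rho r 0 = 0.
Proof.
by rewrite /resolvent_seq /cconv big_ord1 coefZ coefXM !mulr0 mul0r.
Qed.

(** Since - theta F is the sum over the roots of r s F / (1 - r s), applying the weights linearly
    and dividing by E yields the average of the resolvent series. *)
Lemma finR_seqE m rho n : (n <= size rho)%N ->
  finR_seq m rho n = (size rho)%:R^-1 * \sum_(r <- rho) resolvent_seq m rho r n.
Proof.
move=> nd; rewrite /finR_seq /resolvent_seq -cconv_suml mulNr -mulrN; congr (_ * _).
rewrite -mulN1r -cconvZl; apply: eq_cconv => // i lei.
have {}lei := leq_trans lei nd.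
rewrite coef_Epoly // -mulr_sumr -coef_sum.
have -> : \sum_(r <- rho) r *: ('X * revpoly (rem r rho)) = - ('X * (revpoly rho)^`()).
  rewrite deriv_revpoly mulrN opprK mulr_sumr; apply: eq_bigr => r _.
  by rewrite scalerAr.
rewrite coefN coefXM coef_deriv.
case: i {lei} => [|i] /=; rewrite ?mul0r ?mulr0 ?oppr0 ?mulr0 // -mulr_natl.
by ring.
Qed.

Section FixedRoots.
Variables (m : nat) (rho : seq R).
Hypothesis dm : (size rho <= m)%N.
Hypothesis d_gt0 : (0 < size rho)%N.
Let d := size rho.
Let e k := (Epoly m rho)`_k.
Let u := finR_seq m rho.

Let cconv_pinv_e n : cconv (pinv_coef (Epoly m rho)) e n = delta0 n.
Proof. by rewrite cconvC cconv_pinv // Epoly0 oner_eq0. Qed.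

Let cconv_u_e k : k%:R * e k = - d%:R * cconv u e k.
Proof.
rewrite /u /finR_seq cconvZl -cconvA mulrA mulrNN mulfV ?pnatr_eq0 -?lt0n // mul1r.
by under eq_cconv do [over | rewrite cconv_pinv_e]; rewrite cconv_delta0r.
Qed.

Let cconv_z_e r k : cconv (resolvent_seq m rho r) e k =
  rect_weight m d k * (r *: ('X * revpoly (rem r rho)))`_k.
Proof.
rewrite /resolvent_seq -cconvA.
transitivity (cconv (fun k => rect_weight m d k * (r *: ('X * revpoly (rem r rho)))`_k) delta0 k).
  by apply: eq_cconv.
by rewrite cconv_delta0r.
Qed.

(* (1 - (theta-1)/d) (1 - (theta-1)/m) W = r s (E + W) for W = Z_r E. *)
Let resolvent_weighted r k : r \in rho -> (k <= d)%N ->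
  (1 - (k%:R - 1) * d%:R^-1) * ((1 - (k%:R - 1) * m%:R^-1) *
     cconv (resolvent_seq m rho r) e k) =
  r * sshift (fun i => e i + cconv (resolvent_seq m rho r) e i) k.
Proof.
move=> rrho; rewrite cconv_z_e; case: k => [|k] kd /=.
  by rewrite coefZ coefXM !mulr0.
rewrite cconv_z_e /e coef_Epoly ?(ltnW kd) // -natr1 addrK mulrA [LHS]mulrA.
rewrite rect_weightS ?(leq_trans kd) // (revpoly_rem rrho) -mulrDr mulrCA.
congr (_ * _); rewrite coefZ coefXM /= mulrBl mul1r coefB -scalerAl subrK.
by [].
Qed.

(** [resolvent_weighted] is an identity for Z_r E; [conj_euler], used once with h = 1/m and once
    with h = 1/d, moves E to the outside, where it cancels. *)
Lemma resolvent_recursion r n : r \in rho -> (n <= d)%N ->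
  let Y k := (1 - (k%:R - 1) * m%:R^-1) * resolvent_seq m rho r k
             + m%:R^-1 * d%:R * cconv u (resolvent_seq m rho r) k in
  (1 - (n%:R - 1) * d%:R^-1) * Y n + cconv u Y n =
  r * sshift (fun k => delta0 k + resolvent_seq m rho r k) n.
Proof.
move=> rrho nd Y; set z := resolvent_seq m rho r.
have d0 : d%:R != 0 :> R by rewrite pnatr_eq0 -lt0n.
pose L k := (1 - (k%:R - 1) * d%:R^-1) * Y k + cconv u Y k.
pose Q k := r * sshift (fun k => delta0 k + z k) k.
have LQ k : (k <= d)%N -> cconv L e k = cconv Q e k.
  move=> kd; have := resolvent_weighted rrho kd.
  rewrite (conj_euler _ _ _ cconv_u_e) -/Y (conj_euler _ _ _ cconv_u_e) mulVf //.
  under [X in X = _ -> _]eq_cconv do [rewrite mul1r; over | over].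
  rewrite -/L => ->; rewrite /Q cconvZl cconv_sshift; congr (_ * _).
  by case: k {kd} => //= k; rewrite cconvDl cconv_delta0l.
(* Cancellation of E: both sides are multiplied by its reciprocal series, and coefficient [n] only
   uses [LQ] at indices up to [n <= d]. *)
rewrite -/(L n) -/(Q n) -(cconv_delta0r L) -(cconv_delta0r Q).
transitivity (cconv (cconv L e) (pinv_coef (Epoly m rho)) n).
  by rewrite -cconvA; apply: eq_cconv => // i _; rewrite cconvC cconv_pinv_e.
transitivity (cconv (cconv Q e) (pinv_coef (Epoly m rho)) n).
  by apply: eq_cconv => // i lei; apply: LQ; apply: leq_trans lei nd.
by rewrite -cconvA; apply: eq_cconv => // i _; rewrite cconvC cconv_pinv_e.
Qed.

End FixedRoots.
End RectangularRecursion.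

(** * Growth of the coefficients *)

Section ConvolutionSums.
Variable R : realFieldType.
Implicit Types f g : nat -> R.

Definition trunc N f n : R := if (n < N)%N then f n else 0.

(** Partial sums are values at 1 of truncated polynomials, whose product has fewer than 2N
    coefficients. *)
Lemma sum_mul_cconv N f g :
  (\sum_(n < N) f n) * (\sum_(n < N) g n) =
  \sum_(n < N + N) cconv (trunc N f) (trunc N g) n.
Proof.
have sumE (h : nat -> R) : \sum_(n < N) h n = (\poly_(n < N) h n).[1].
  by rewrite horner_poly; apply: eq_bigr => i _; rewrite expr1n mulr1.
rewrite !sumE -hornerM (@horner_coef_wide _ (N + N)); last first.
  apply: leq_trans (size_polyMleq _ _) _; rewrite -subn1 leq_subLR addnC.
  by rewrite (leq_trans (leq_add (size_poly _ _) (size_poly _ _))) // leq_addr.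
apply: eq_bigr => n _; rewrite expr1n mulr1 coefM; apply: eq_bigr => i _.
by rewrite !coef_poly.
Qed.

Lemma cconv_ge0 f g n : (forall i, 0 <= f i) -> (forall i, 0 <= g i) -> 0 <= cconv f g n.
Proof. by move=> f0 g0; apply: sumr_ge0 => i _; rewrite mulr_ge0. Qed.

Lemma le_cconv f f' g g' n :
  (forall i, (i <= n)%N -> 0 <= f i <= f' i) ->
  (forall i, (i <= n)%N -> 0 <= g i <= g' i) -> cconv f g n <= cconv f' g' n.
Proof.
move=> ff gg; apply: ler_sum => -[i /=]; rewrite ltnS => lei _.
have /andP[? ?] := ff _ lei; have /andP[? ?] := gg _ (leq_subr i n).
exact: ler_pM.
Qed.

Lemma normr_cconv f g n :
  `|cconv f g n| <= cconv (fun i => `|f i|) (fun i => `|g i|) n.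
Proof.
by apply: le_trans (ler_norm_sum _ _ _) _; apply: ler_sum => i _; rewrite normrM.
Qed.

Lemma cconv_trunc N f g n : (n < N)%N ->
  cconv (trunc N f) (trunc N g) n = cconv f g n.
Proof.
move=> nN; apply: eq_cconv => i lei; rewrite /trunc ifT //;
  exact: leq_ltn_trans lei nN.
Qed.

Lemma trunc_ge0 N f n : (forall i, 0 <= f i) -> 0 <= trunc N f n.
Proof. by rewrite /trunc; case: ifP. Qed.

Lemma sum_ord_mono (N M : nat) f : (N <= M)%N -> (forall i, 0 <= f i) ->
  \sum_(n < N) f n <= \sum_(n < M) f n.
Proof.
move=> NM f0; rewrite -(subnKC NM) big_split_ord /= lerDl.
by apply: sumr_ge0.
Qed.

Lemma sum_cconv_le N f g : (forall i, 0 <= f i) -> (forall i, 0 <= g i) ->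
  \sum_(n < N) cconv f g n <= (\sum_(n < N) f n) * (\sum_(n < N) g n).
Proof.
move=> f0 g0; rewrite sum_mul_cconv.
apply: le_trans (sum_ord_mono (leq_addr N N) _); last first.
  by move=> i; apply: cconv_ge0 => j; apply: trunc_ge0.
by apply: ler_sum => n _; rewrite cconv_trunc.
Qed.

(** With vanishing constant terms, coefficient [n] of a product does not see index [n] of either
    factor. This is what makes the nonlinear recursions explicit. *)
Lemma eq_cconv_lt f f' g g' n :
  f 0%N = 0 -> f' 0%N = 0 -> g 0%N = 0 -> g' 0%N = 0 ->
  (forall i, (i < n)%N -> f i = f' i) -> (forall i, (i < n)%N -> g i = g' i) ->
  cconv f g n = cconv f' g' n.
Proof.
move=> f0 f'0 g0 g'0 ff gg; apply: eq_bigr => -[i /=]; rewrite ltnS => lei _.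
have [->|i0] := posnP i; first by rewrite f0 f'0 !mul0r.
have [ilt|] := ltnP i n; last first.
  by rewrite leq_eqVlt ltnNge lei orbF => /eqP ->; rewrite subnn g0 g'0 !mulr0.
by rewrite ff // gg // ltn_subrL i0 (leq_trans _ ilt).
Qed.

Lemma cconv00 f g : f 0%N = 0 -> cconv f g 0 = 0.
Proof. by move=> f0; rewrite /cconv big_ord1 f0 mul0r. Qed.

Lemma cconv_scale f g s n :
  cconv f g n * s ^+ n = cconv (fun i => f i * s ^+ i) (fun i => g i * s ^+ i) n.
Proof.
rewrite /cconv mulr_suml; apply: eq_bigr => -[i /=]; rewrite ltnS => lei _.
have -> : s ^+ n = s ^+ i * s ^+ (n - i) by rewrite -exprD subnKC.
exact: mulrACA.
Qed.

(* With [s = 1 / (16 B)], the bound [1/8] on the partial sums of [a n * s ^ n] is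
   reproduced by the inequality: 9/8 * 1/16 + 2/64 + 1/512 <= 1/8. *)
Lemma cubic_growth (a : nat -> R) (B : R) (d : nat) :
  0 < B -> (forall n, 0 <= a n) -> a 0%N = 0 ->
  (forall n, (n < d)%N -> a n.+1 <=
     B * (delta0 n + a n) + 2 * cconv a a n.+1 + cconv a (cconv a a) n.+1) ->
  forall n, (n <= d)%N -> a n <= 8^-1 * (16 * B) ^+ n.
Proof.
move=> B0 a_ge0 a0 arec; pose s := (16 * B)^-1.
have s0 : 0 < s by rewrite invr_gt0 mulr_gt0.
pose b n := a n * s ^+ n.
have b_ge0 n : 0 <= b n by rewrite mulr_ge0 // exprn_ge0 // ltW.
have b0 : b 0%N = 0 by rewrite /b a0 mul0r.
(* Bounding whole partial sums, not single terms, lets convolutions be estimated by products of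
   sums. *)
suff S N : (N <= d)%N -> \sum_(n < N.+1) b n <= 8^-1.
  move=> n nd; have := S n nd; rewrite big_ord_recr /= => le8.
  have : b n <= 8^-1 by apply: le_trans le8; rewrite lerDr sumr_ge0.
  by rewrite /b /s exprVn ler_pdivrMr // exprn_gt0 // mulr_gt0.
elim: N => [|N IH] Nd; first by rewrite big_ord1 b0 invr_ge0.
have {IH}SN := IH (ltnW Nd); set S := \sum_(n < _) b n in SN.
have S0 : 0 <= S by apply: sumr_ge0.
(* As [b 0 = 0], the convolutions of [b] up to index [N+1] use only [b] up to [N]; replacing [b] by
   its truncation bounds their sums by powers of [S] alone. *)
pose f := trunc N.+1 b.
have f_ge0 n : 0 <= f n by apply: trunc_ge0.
have f0 : f 0%N = 0 by rewrite /f /trunc /= b0.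
have fS : \sum_(n < N.+2) f n = S.
  rewrite big_ord_recr /= {2}/f /trunc ltnn addr0; apply: eq_bigr => i _.
  by rewrite /f /trunc ltn_ord.
have ff n : (n <= N.+1)%N -> cconv b b n = cconv f f n.
  by move=> nN; apply: eq_cconv_lt => // i lti; rewrite /f /trunc (leq_trans lti).
have fff n : (n <= N.+1)%N -> cconv b (cconv b b) n = cconv f (cconv f f) n.
  move=> nN; apply: eq_cconv_lt; rewrite ?cconv00 // => i lti.
    by rewrite /f /trunc (leq_trans lti).
  by apply: ff; rewrite (leq_trans (ltnW lti)).
have ff_ge0 n : 0 <= cconv f f n by apply: cconv_ge0.
have fff_ge0 n : 0 <= cconv f (cconv f f) n by apply: cconv_ge0.
have sum_ff : \sum_(n < N.+2) cconv f f n <= S * S.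
  by rewrite -{1}fS -fS; apply: sum_cconv_le.
have sum_fff : \sum_(n < N.+2) cconv f (cconv f f) n <= S * (S * S).
  rewrite -{1}fS; apply: le_trans (sum_cconv_le _ _ _) _ => //.
  by rewrite ler_wpM2l // fS.
rewrite big_ord_recl b0 add0r.
(* Of the factor s^(i+1), one s turns [B] into 1/16 and the other s^i rescales [a i] into [b i];
   [delta0] is unaffected by the scaling. *)
have step (i : 'I_N.+1) : b (lift ord0 i) <=
    16^-1 * (delta0 i + b i) + 2 * cconv f f (lift ord0 i) + cconv f (cconv f f) (lift ord0 i).
  rewrite lift0 -ff // -fff //; have iN : (i <= N)%N by rewrite -ltnS.
  have := arec i (leq_ltn_trans iN Nd).
  have sn0 : 0 < s ^+ i.+1 by rewrite exprn_gt0.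
  rewrite -(ler_pM2r sn0) => /le_trans; apply; rewrite le_eqVlt; apply/orP; left; apply/eqP.
  have -> : cconv b (cconv b b) i.+1 = cconv a (cconv a a) i.+1 * s ^+ i.+1.
    by rewrite cconv_scale; apply: eq_cconv => // j _; rewrite cconv_scale.
  rewrite -(cconv_scale a a) !mulrDl !mulrA; congr (_ + _ + _).
  have dE : delta0 i = delta0 i * s ^+ i :> R.
    by rewrite /delta0; case: (nat_of_ord i) => [|k]; rewrite ?expr0 ?mulr1 ?mul0r.
  have sE : B * s = 16^-1 by rewrite /s invfM mulrCA mulfV ?mulr1 // gt_eqF.
  transitivity (B * s * ((delta0 i + a i) * s ^+ i)); first by rewrite exprS; ring.
  by rewrite sE mulrDl -dE.
apply: le_trans (ler_sum _ (fun i _ => step i)) _.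
rewrite !big_split /= -!mulr_sumr !big_split /= -/S.
have -> : \sum_(i < N.+1) delta0 i = 1 :> R.
  by rewrite big_ord_recl big1 ?addr0.
move: sum_ff sum_fff; rewrite !(big_ord_recl N.+1) !cconv00 // !add0r.
set p := \sum_(i < _) _; set q := \sum_(i < _) _ => pS qS.
nra.
Qed.

End ConvolutionSums.

(** * Bounds on the weights and geometric growth of the resolvent coefficients *)

Section WeightBounds.
Variable R : realType.
Implicit Types (m d n k : nat).
Local Notation W := (rect_weight R).

Lemma rect_weight_gt0 m d n : (0 < d)%N -> (0 < m)%N -> 0 < W m d n.
Proof.
move=> d0 m0; rewrite /rect_weight mulr_gt0 ?exprn_gt0 ?divr_gt0 //;
 by rewrite ltr0n muln_gt0 ?fact_gt0 ?d0 ?m0.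
Qed.

(** Passing from d to d+1 costs a factor (1 + 1/d)^n <= e^(n/d) <= e, which pays for the one extra
    power of e. *)
Lemma fall_bound d n : (n <= d)%N ->
  d%:R ^+ n * ((d - n)`!)%:R / (d`!)%:R <= expR 1 ^+ n :> R.
Proof.
elim: d n => [|d IH] n.
  by rewrite leqn0 => /eqP ->; rewrite !expr0 mul1r subn0 divff.
case: n => [_|n nd].
  by rewrite !expr0 mul1r subn0 divff // pnatr_eq0 -lt0n fact_gt0.
rewrite subSS factS natrM exprS; rewrite ltnS in nd.
have e0 : 0 < d.+1%:R :> R by rewrite ltr0n.
have -> : d.+1%:R * d.+1%:R ^+ n * (d - n)`!%:R / (d.+1%:R * d`!%:R) =
   d.+1%:R ^+ n * ((d - n)`!%:R / d`!%:R) :> R.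
  move: (d.+1%:R) e0 => M M0; field; apply/andP; split; rewrite gt_eqF //;
  by rewrite ltr0n fact_gt0.
rewrite exprS; apply: le_trans (ler_wpM2l (expR_ge0 1) (IH n nd)); rewrite -!mulrA.
rewrite [leRHS]mulrA ler_wpM2r ?divr_ge0 //.
have [d0|d0] := posnP d.
  by move: nd; rewrite d0 leqn0 => /eqP ->; rewrite !expr0 mulr1 -expR0 ler_expR.
have d0' : 0 < d%:R :> R by rewrite ltr0n.
rewrite -ler_pdivrMr ?exprn_gt0 // -expr_div_n.
apply: le_trans (_ : expR (d%:R^-1) ^+ n <= _).
  rewrite lerXn2r ?nnegrE ?divr_ge0 ?expR_ge0 //.
  rewrite -natr1 mulrDl divff ?gt_eqF // mul1r; exact: expR_ge1Dx.
by rewrite -expRM_natl ler_expR ler_pdivrMr // mul1r ler_nat.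
Qed.

Lemma rect_weight_le m d n : (n <= d)%N -> (n <= m)%N ->
  W m d n <= (expR 1 ^+ 2) ^+ n.
Proof.
move=> nd nm.
have -> : W m d n = (m%:R ^+ n * ((m - n)`!)%:R / (m`!)%:R) *
                    (d%:R ^+ n * ((d - n)`!)%:R / (d`!)%:R).
  rewrite /rect_weight !natrM exprMn; field.
  by rewrite !pnatr_eq0 -!lt0n !fact_gt0.
rewrite expr2 exprMn ler_pM ?fall_bound // !mulr_ge0 // ?exprn_ge0 ?invr_ge0 //.
Qed.

Section Fixed.
Variables (m d : nat).
Hypotheses (d0 : (0 < d)%N) (dm : (d <= m)%N).

Let W_gt0 n : 0 < W m d n.
Proof. by apply: rect_weight_gt0 => //; apply: leq_trans d0 dm. Qed.

Let dgt0 : 0 < d%:R :> R. Proof. by rewrite ltr0n. Qed.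
Let mgt0 : 0 < m%:R :> R. Proof. by rewrite ltr0n (leq_trans d0). Qed.

(** The quotient c_n / c_(n+1), positive and decreasing for n < d. *)
Let ratio n : R := (1 - n%:R / d%:R) * (1 - n%:R / m%:R).

Let fac01 k n : (n < k)%N -> 0 < 1 - (n%:R / k%:R : R) <= 1.
Proof.
move=> nk; have k0 : 0 < k%:R :> R by rewrite ltr0n (leq_ltn_trans _ nk).
by rewrite subr_gt0 ltr_pdivrMr // mul1r ltr_nat nk /= gerBl divr_ge0.
Qed.

Let ratio_gt0 n : (n < d)%N -> 0 < ratio n.
Proof.
move=> nd; have /andP[? _] := fac01 nd; have /andP[? _] := fac01 (leq_trans nd dm).
exact: mulr_gt0.
Qed.

Let ratio_mono i j : (i <= j)%N -> (j < d)%N -> ratio j <= ratio i.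
Proof.
move=> ij jd; have /andP[? _] := fac01 jd; have /andP[? _] := fac01 (leq_trans jd dm).
apply: ler_pM; [exact: ltW | exact: ltW | |];
  by rewrite lerB // ler_pM2r ?invr_gt0 // ler_nat.
Qed.

Let WS n : (n < d)%N -> W m d n.+1 = W m d n / ratio n.
Proof.
move=> nd; rewrite -(rect_weightS R nd (leq_trans nd dm)) -/(ratio n) mulrAC.
by rewrite mulfV ?mul1r // gt_eqF ?ratio_gt0.
Qed.

Lemma rect_weight_mono n : (n < d)%N -> W m d n <= W m d n.+1.
Proof.
move=> nd; rewrite WS // ler_peMr ?(ltW (W_gt0 _)) // invf_ge1 ?ratio_gt0 //.
have /andP[a0 a1] := fac01 nd; have /andP[b0 b1] := fac01 (leq_trans nd dm).
by rewrite mulr_ile1 // ltW.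
Qed.

Lemma rect_weight_ge1 n : (n <= d)%N -> 1 <= W m d n.
Proof.
elim: n => [|n IH] nd; first by rewrite rect_weight0.
exact: le_trans (IH (ltnW nd)) (rect_weight_mono nd).
Qed.

(** Equality holds at [i = 0] because c_1 = 1. Raising [i] divides the left side by [ratio] at [i+1]
    and the right side by the smaller [ratio] at [i+j+1]. *)
Lemma rect_weightM i j : (i + j < d)%N -> W m d i.+1 * W m d j.+1 <= W m d (i + j).+1.
Proof.
elim: i => [|i IH] ijd.
  have W1 : W m d 1 = 1 by rewrite WS // rect_weight0 /ratio !mul0r subr0 mulr1 divr1.
  by rewrite W1 mul1r.
have lti : (i.+1 < d)%N by apply: leq_ltn_trans ijd; rewrite leq_addr.
rewrite (WS lti) addSn (@WS (i + j).+1) // mulrAC.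
have := IH (ltnW ijd) => {}IH.
apply: ler_pM => //; first by rewrite mulr_ge0 ?ltW.
  by rewrite invr_ge0 ltW ?ratio_gt0.
rewrite lef_pV2 ?posrE ?ratio_gt0 //; apply: ratio_mono => //.
by rewrite ltnS leq_addr.
Qed.

(** Coefficient [n+1] of a product without constant terms costs only c_n, one index less than
    expected; this gain offsets the small factor c_n / c_(n+1) in front of the leading term of the
    recursion. *)
Lemma cconv_weight_le (f f' g g' : nat -> R) n : (n < d)%N ->
  (forall i, (i <= d)%N -> 0 <= f i <= W m d i * g i) ->
  (forall i, (i <= d)%N -> 0 <= f' i <= W m d i * g' i) ->
  (forall i, 0 <= g i) -> (forall i, 0 <= g' i) -> g 0%N = 0 -> g' 0%N = 0 ->
  cconv f f' n.+1 <= W m d n * cconv g g' n.+1.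
Proof.
move=> nd fg fg' g_ge0 g'_ge0 g0 g'0; rewrite mulr_sumr; apply: ler_sum => -[i /=].
rewrite ltnS => lei _; have id : (i <= d)%N := leq_trans lei nd.
have jd : (n.+1 - i <= d)%N := leq_trans (leq_subr _ _) nd.
have /andP[fi fgi] := fg _ id; have /andP[fj fgj] := fg' _ jd.
apply: le_trans (ler_pM fi fj fgi fgj) _; rewrite mulrACA.
case: i lei {id jd fi fgi fj fgj} => [|i]; first by rewrite g0 !mul0r !mulr0.
rewrite ltnS subSS leq_eqVlt => /orP[/eqP ->|lein].
  by rewrite subnn g'0 !mulr0.
rewrite ler_wpM2r ?mulr_ge0 //; have -> : (n - i = (n - i.+1).+1)%N by rewrite subnSK.
have nE : (n = (i + (n - i.+1)).+1)%N by rewrite -addSn subnKC.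
rewrite {2}nE; apply: rect_weightM; apply: leq_ltn_trans nd.
by rewrite [X in (_ <= X)%N]nE.
Qed.

(** Summing |z| over the atoms and dividing by c_n gives a sequence to which [cubic_growth] applies
    with a constant free of d and m; c_n itself is at most e^(2n). *)
Lemma resolvent_growth (xs : seq R) (rt wt : R -> R) (z : R -> nat -> R)
    (u : nat -> R) (A : R) : 0 < A ->
  (forall x, x \in xs -> 0 <= rt x <= A) ->
  (forall x, x \in xs -> 0 <= wt x <= 1) ->
  (forall x, z x 0%N = 0) ->
  (forall n, (n <= d)%N -> u n = \sum_(x <- xs) wt x * z x n) ->
  (forall x n, x \in xs -> (n <= d)%N ->
    let Y k := (1 - (k%:R - 1) * m%:R^-1) * z x k + m%:R^-1 * d%:R * cconv u (z x) k in
    (1 - (n%:R - 1) * d%:R^-1) * Y n + cconv u Y n =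
    rt x * sshift (fun k => delta0 k + z x k) n) ->
  forall n, (n <= d)%N ->
    \sum_(x <- xs) `|z x n| <= 8^-1 * (expR 1 ^+ 2 * (16 * (A * (size xs).+1%:R))) ^+ n.
Proof.
move=> A0 rtA wt1 z0 uE rec n nd.
pose zz n : R := \sum_(x <- xs) `|z x n|; pose a n : R := zz n / W m d n.
have zz_ge0 k : 0 <= zz k by apply: sumr_ge0.
have a_ge0 k : 0 <= a k by rewrite divr_ge0 // ltW.
have zza k : zz k = W m d k * a k by rewrite mulrC divfK // gt_eqF.
have zz0 : zz 0%N = 0 by rewrite /zz big1 // => x _; rewrite z0 normr0.
have a0 : a 0%N = 0 by rewrite /a zz0 mul0r.
have uzz k : (k <= d)%N -> `|u k| <= zz k.
  move=> kd; rewrite uE //; apply: le_trans (ler_norm_sum _ _ _) _.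
  rewrite /zz big_seq [leRHS]big_seq; apply: ler_sum => x /wt1 /andP[w0 w1].
  by rewrite normrM ger0_norm // ler_piMl.
suff : a n <= 8^-1 * (16 * (A * (size xs).+1%:R)) ^+ n.
  rewrite -/(zz n) zza [(expR 1 ^+ 2 * _) ^+ n]exprMn => an; rewrite [leRHS]mulrCA.
  apply: ler_pM => //; first exact: ltW (W_gt0 _).
  by rewrite rect_weight_le // (leq_trans nd).
(* Summing [delta0] over the atoms produces [size xs]; the successor also covers the coefficient 1
   of [a n] and keeps the constant positive when [xs] is empty. *)
apply: (@cubic_growth R a (A * (size xs).+1%:R) d) => //.
  by rewrite mulr_gt0 // ltr0n.
move=> {nd} {}n nd.
(* The recursion is solved for its leading term. The coefficient 2 counts u z twice: once from the
   quadratic part of [Y], once from u times the linear part of [Y]. *)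
have term x : x \in xs -> ratio n * `|z x n.+1| <=
    A * (delta0 n + `|z x n|) + 2 * cconv zz (fun k => `|z x k|) n.+1
    + cconv zz (cconv zz (fun k => `|z x k|)) n.+1.
  move=> xxs; have /= := rec x n.+1 xxs nd; rewrite -natr1 addrK.
  set Y := (fun k => _ + _) => recE.
  have md1 : 0 <= (m%:R^-1 * d%:R : R) <= 1.
    by rewrite mulr_ge0 ?invr_ge0 //= mulrC ler_pdivrMr // mul1r ler_nat.
  have Yle k : (k <= d)%N -> `|Y k| <= `|z x k| + cconv zz (fun k => `|z x k|) k.
    move=> kd; apply: le_trans (ler_normD _ _) _; rewrite !normrM; apply: lerD.
      case: k kd => [|k] kd; first by rewrite z0 normr0 mulr0.
      have /andP[? ?] := fac01 (leq_trans kd dm).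
      by rewrite -natr1 addrK ler_piMl // gtr0_norm.
    have /andP[? ?] := md1.
    rewrite -normrM ger0_norm // -[leRHS]mul1r; apply: ler_pM => //.
    apply: le_trans (normr_cconv _ _ _) _; apply: le_cconv => i lei; rewrite normr_ge0 //=.
    by apply: uzz; apply: leq_trans lei kd.
  have uz : `|cconv u (z x) n.+1| <= cconv zz (fun k => `|z x k|) n.+1.
    apply: le_trans (normr_cconv _ _ _) _; apply: le_cconv => i lei; rewrite normr_ge0 //=.
    by apply: uzz; apply: leq_trans lei nd.
  have uY : `|cconv u Y n.+1| <= cconv zz (fun k => `|z x k|) n.+1
       + cconv zz (cconv zz (fun k => `|z x k|)) n.+1.
    rewrite -cconvDr; apply: le_trans (normr_cconv _ _ _) _.
    apply: le_cconv => i lei; rewrite normr_ge0 /=.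
      by apply: uzz; apply: leq_trans lei nd.
    by apply: Yle; apply: leq_trans lei nd.
  have /andP[f0 f1] := fac01 nd; have /andP[h0 h1] := fac01 (leq_trans nd dm).
  have E : ratio n * z x n.+1 = rt x * (delta0 n + z x n)
     - (1 - n%:R / d%:R) * (m%:R^-1 * d%:R * cconv u (z x) n.+1) - cconv u Y n.+1.
    rewrite -recE /ratio; ring.
  rewrite -(gtr0_norm (ratio_gt0 nd)) -normrM E.
  apply: le_trans (ler_normB _ _) _.
  rewrite [2 * _]mulr_natl mulr2n !addrA -[leRHS]addrA; apply: lerD => //.
  apply: le_trans (ler_normB _ _) _; apply: lerD.
    have /andP[? ?] := rtA _ xxs; rewrite normrM ger0_norm //; apply: ler_pM => //.
    by apply: le_trans (ler_normD _ _) _; rewrite (ger0_norm (ler0n _ _)).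
  have /andP[? ?] := md1.
  rewrite mulrA normrM -[leRHS]mul1r; apply: ler_pM => //.
  rewrite ger0_norm ?mulr_ge0 // ?(ltW f0) // mulr_ile1 // ltW //.
have total : ratio n * zz n.+1 <= A * ((size xs)%:R * delta0 n + zz n)
    + 2 * cconv zz zz n.+1 + cconv zz (cconv zz zz) n.+1.
  have cE k : cconv zz zz k = \sum_(x <- xs) cconv zz (fun k => `|z x k|) k.
    by rewrite {1}/zz cconv_suml; apply: eq_bigr => x _; rewrite cconvC.
  have ccE k : cconv zz (cconv zz zz) k =
      \sum_(x <- xs) cconv zz (cconv zz (fun k => `|z x k|)) k.
    rewrite cconvC.
    transitivity (cconv (fun i => \sum_(x <- xs) cconv zz (fun k => `|z x k|) i) zz k).
      exact: eq_cconv.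
    by rewrite cconv_suml; apply: eq_bigr => x _; rewrite cconvC.
  have -> : ratio n * zz n.+1 = \sum_(x <- xs) ratio n * `|z x n.+1| by rewrite mulr_sumr.
  apply: le_trans (_ : \sum_(x <- xs) (A * (delta0 n + `|z x n|) +
    2 * cconv zz (fun k => `|z x k|) n.+1 +
    cconv zz (cconv zz (fun k => `|z x k|)) n.+1) <= _).
    by rewrite big_seq [leRHS]big_seq; apply: ler_sum.
  rewrite !big_split /= -!mulr_sumr big_split /= -cE -ccE.
  by rewrite big_const_seq count_predT iter_addr_0 mulr_natl.
(* Writing c_(n+1) as c_n / [ratio n] absorbs the factor in [total] and leaves the same c_n that
   [cconv_weight_le] produces. *)
have aE : a n.+1 = ratio n * zz n.+1 / W m d n.
  by rewrite {1}/a WS // invf_div mulrCA mulrA.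
have zz_a k : (k <= d)%N -> 0 <= zz k <= W m d k * a k.
  by move=> _; rewrite zz_ge0 zza lexx.
have c2 : cconv zz zz n.+1 <= W m d n * cconv a a n.+1 by apply: cconv_weight_le.
have c3 : cconv zz (cconv zz zz) n.+1 <= W m d n * cconv a (cconv a a) n.+1.
  apply: cconv_weight_le => //; last by rewrite cconv00.
    move=> k kd; rewrite cconv_ge0 //=; case: k kd => [|k] kd.
      by rewrite !cconv00 // mulr0.
    (* The inner product gives c_k at index [k+1]; monotonicity raises it to c_(k+1), the form
       required to convolve once more. *)
    apply: le_trans (cconv_weight_le kd zz_a zz_a _ _ _ _) _ => //.
    by rewrite ler_wpM2r ?cconv_ge0 // rect_weight_mono.
  by move=> k; apply: cconv_ge0.
rewrite aE ler_pdivrMr //; apply: le_trans total _.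
rewrite zza -[(size xs).+1%:R]natr1; move: (rect_weight_ge1 (ltnW nd)) (a_ge0 n) c2 c3.
move: (ler0n R (size xs)) (ler0n R (n == 0%N)); rewrite -/(delta0 n).
move: (cconv _ _ _) (cconv _ _ _) (cconv _ _ _) (cconv _ _ _).
move: (W m d n) (a n) (size xs)%:R (delta0 n) => w b s e p q p' q' s0 e0 w1 b0 c2 c3.
(* The constant term carries no weight of its own; c_n >= 1 supplies it. *)
have h1 : s * e <= s * e * w by rewrite ler_peMr // mulr_ge0.
have h2 : 0 <= e * w by rewrite mulr_ge0 // (le_trans ler01).
have h3 : 0 <= s * b * w by rewrite !mulr_ge0 // (le_trans ler01).
have h4 : A * (s * e + w * b) <= A * ((s + 1) * (e + b) * w) by rewrite ler_pM2l //; lra.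
by lra.
Qed.

End Fixed.
End WeightBounds.

(** * Coefficientwise limit *)

Section LimitAlongFilter.
Local Open Scope classical_set_scope.
Variables (R : realType) (F : set_system nat).
Context {PF : ProperFilter F}.

Lemma cvg_sumr (I : eqType) (s : seq I) (f : I -> nat -> R) (l : I -> R) :
  (forall i, i \in s -> f i d @[d --> F] --> l i) ->
  \sum_(i <- s) f i d @[d --> F] --> \sum_(i <- s) l i.
Proof.
elim: s => [|i s IH] fl.
  by under eq_fun do rewrite big_nil; rewrite big_nil; apply: cvg_cst.
under eq_fun do rewrite big_cons; rewrite big_cons; apply: cvgD.
  by apply: fl; rewrite mem_head.
by apply: IH => j js; apply: fl; rewrite in_cons js orbT.
Qed.

(** Limit version of [eq_cconv_lt]: convergence strictly below [n] suffices, as the induction in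
    [cvg_main] requires. *)
Lemma cvg_cconv_lt (f g : nat -> nat -> R) (lf lg : nat -> R) n :
  (forall d, f d 0%N = 0) -> (forall d, g d 0%N = 0) -> lf 0%N = 0 -> lg 0%N = 0 ->
  (forall k, (k < n)%N -> f d k @[d --> F] --> lf k) ->
  (forall k, (k < n)%N -> g d k @[d --> F] --> lg k) ->
  cconv (f d) (g d) n @[d --> F] --> cconv lf lg n.
Proof.
move=> f0 g0 lf0 lg0 fl gl; apply: cvg_sumr => -[i ilt] _ /=.
have {ilt}lei : (i <= n)%N by rewrite -ltnS.
have [->|i0] := posnP i.
  by rewrite lf0 mul0r; under eq_fun do rewrite f0 mul0r; apply: cvg_cst.
have [ilt|nlt] := ltnP i n; last first.
  have -> : i = n by apply/eqP; rewrite eqn_leq lei.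
  by rewrite subnn lg0 mulr0; under eq_fun do rewrite g0 mulr0; apply: cvg_cst.
by apply: cvgM; [apply: fl | apply: gl; rewrite ltn_subrL i0 (leq_trans _ ilt)].
Qed.

Variables (xs : seq R) (wt rt : R -> R) (lam : R) (m : nat -> nat).
Variables (z : nat -> R -> nat -> R) (u : nat -> nat -> R).
Hypothesis F_oo : F --> \oo.
Hypothesis z0 : forall d x, z d x 0%N = 0.
Hypothesis u0 : forall d, u d 0%N = 0.

Let Y d x k := (1 - (k%:R - 1) * (m d)%:R^-1) * z d x k
  + (m d)%:R^-1 * d%:R * cconv (u d) (z d x) k.

Hypothesis Fd : \forall d \near F, [/\ (0 < d)%N, (d <= m d)%N,
  (m d)%:R^-1 * d%:R = lam &
  forall n, (n <= d)%N -> u d n = \sum_(x <- xs) wt x * z d x n /\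
    forall x, x \in xs -> (1 - (n%:R - 1) * d%:R^-1) * Y d x n + cconv (u d) (Y d x) n =
      rt x * sshift (fun k => delta0 k + z d x k) n].

(** Only candidates at this point: [cvg_main] shows that these limits are attained, for the atoms in
    [xs]. *)
Let zeta x n : R := lim (z d x n @[d --> F]).
Let r n : R := lim (u d n @[d --> F]).

Let zeta0 x : zeta x 0 = 0.
Proof. by rewrite /zeta; under eq_fun do rewrite z0; apply: lim_cst. Qed.

Let r0 : r 0 = 0.
Proof. by rewrite /r; under eq_fun do rewrite u0; apply: lim_cst. Qed.

Let near_ge n : \forall d \near F, (n <= d)%N.
Proof. by apply: F_oo; apply: nbhs_infty_ge. Qed.

Let cvg_invn : (d%:R : R)^-1 @[d --> F] --> (0 : R).
Proof.
apply: cvg_trans (_ : (d%:R : R)^-1 @[d --> \oo] --> (0 : R)).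
  exact: cvg_app F_oo.
apply/gtr0_cvgV0; last exact: cvgr_idn.
by near=> d; rewrite ltr0n; near: d; apply: nbhs_infty_ge.
Unshelve. all: by end_near. Qed.

Let cvg_fac k : (1 - (k%:R - 1) * (d%:R : R)^-1) @[d --> F] --> (1 : R).
Proof.
suff : (1 - (k%:R - 1) * (d%:R : R)^-1) @[d --> F] --> (1 - (k%:R - 1) * 0 : R).
  by rewrite mulr0 subr0.
by apply: cvgB; [apply: cvg_cst | apply: cvgM => //; apply: cvg_cst].
Qed.

Let cvg_fac_m k : (1 - (k%:R - 1) * ((m d)%:R : R)^-1) @[d --> F] --> (1 : R).
Proof.
apply: cvg_trans (_ : (1 - (k%:R - 1) * (lam * (d%:R : R)^-1)) @[d --> F] --> (1 : R)).
  apply: near_eq_cvg; near=> d; have [d0 _ <- _] : [/\ (0 < d)%N, (d <= m d)%N,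
    (m d)%:R^-1 * d%:R = lam & True] by near: d; apply: filterS Fd => d [].
  by rewrite mulfK // pnatr_eq0 -lt0n.
suff : (1 - (k%:R - 1) * (lam * (d%:R : R)^-1)) @[d --> F] --> (1 - (k%:R - 1) * (lam * 0) : R).
  by rewrite !mulr0 subr0.
apply: cvgB; first exact: cvg_cst.
by apply: cvgM; [apply: cvg_cst | apply: cvgM => //; apply: cvg_cst].
Unshelve. all: by end_near. Qed.

Let cvg_lam : (m d)%:R^-1 * d%:R @[d --> F] --> lam.
Proof.
apply: cvg_trans (_ : lam @[d --> F] --> lam); last exact: cvg_cst.
apply: near_eq_cvg; near=> d; symmetry.
by near: d; apply: filterS Fd => d [].
Unshelve. all: by end_near. Qed.

Let lY x k := zeta x k + lam * cconv r (zeta x) k.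
(** The limiting recursion solved for its leading coefficient, both prefactors having become 1. It
    depends on indices below [n] only, since [r] and [zeta x] vanish at 0. *)
Let lz x n := rt x * sshift (fun k => delta0 k + zeta x k) n - cconv r (lY x) n
  - lam * cconv r (zeta x) n.

Let fac_neq0 (k n : nat) : (0 < k)%N -> (n <= k)%N -> 1 - (n%:R - 1) * (k%:R : R)^-1 != 0.
Proof.
move=> k0 nk; have k0' : 0 < k%:R :> R by rewrite ltr0n.
rewrite gt_eqF // subr_gt0 ltr_pdivrMr // mul1r ltrBlDr natr1.
by rewrite ltr_nat ltnS.
Qed.

Let cvg_main n : (forall x, x \in xs -> z d x n @[d --> F] --> lz x n) /\
  (forall x, x \in xs -> z d x n @[d --> F] --> zeta x n) /\
  (u d n @[d --> F] --> r n) /\ r n = \sum_(x <- xs) wt x * zeta x n.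
Proof.
elim/ltn_ind: n => n IH.
have cz x k : x \in xs -> (k < n)%N -> z d x k @[d --> F] --> zeta x k.
  by move=> xxs /IH[_ [+ _]]; apply.
have cu k : (k < n)%N -> u d k @[d --> F] --> r k by move=> /IH[_ [_ []]].
have cuz x k : x \in xs -> (k <= n)%N ->
    cconv (u d) (z d x) k @[d --> F] --> cconv r (zeta x) k.
  move=> xxs kn; apply: cvg_cconv_lt => // j jk; first by apply: cu; apply: leq_trans jk kn.
  by apply: cz => //; apply: leq_trans jk kn.
have cY x k : x \in xs -> (k < n)%N -> Y d x k @[d --> F] --> lY x k.
  move=> xxs kn; rewrite /Y /lY -[X in _ --> X + _]mul1r; apply: cvgD.
    by apply: cvgM; [exact: cvg_fac_m | exact: cz].
  by apply: cvgM; [exact: cvg_lam | apply: cuz => //; apply: ltnW].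
have cuY x : x \in xs -> cconv (u d) (Y d x) n @[d --> F] --> cconv r (lY x) n.
  move=> xxs; apply: cvg_cconv_lt => //.
  - by move=> d; rewrite /Y z0 cconv00 // !mulr0 addr0.
  - by rewrite /lY zeta0 cconv00 // mulr0 addr0.
  - by move=> k kn; apply: cY.
have clz x : x \in xs -> z d x n @[d --> F] --> lz x n.
  move=> xxs.
  (* At finite d the coefficient is recovered by dividing by the two prefactors, which are nonzero
     once n <= d and tend to 1. *)
  apply: cvg_trans (_ : ((rt x * sshift (fun k => delta0 k + z d x k) n
     - cconv (u d) (Y d x) n) / (1 - (n%:R - 1) * (d%:R : R)^-1)
     - ((m d)%:R^-1 * d%:R) * cconv (u d) (z d x) n) / (1 - (n%:R - 1) * ((m d)%:R : R)^-1)
       @[d --> F] --> lz x n).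
    apply: near_eq_cvg; near=> d.
    have : (n <= d)%N by near: d.
    have [d0 dm _] : [/\ (0 < d)%N, (d <= m d)%N,
      (m d)%:R^-1 * d%:R = lam &
      forall n, (n <= d)%N -> u d n = \sum_(x <- xs) wt x * z d x n /\
       forall x, x \in xs -> (1 - (n%:R - 1) * d%:R^-1) * Y d x n + cconv (u d) (Y d x) n =
       rt x * sshift (fun k => delta0 k + z d x k) n] by near: d.
    move=> H nd; have [_ {}H] := H n nd; rewrite -(H x xxs) addrK.
    have mulKr (c y : R) : c != 0 -> c * y / c = y.
      by move=> c0; rewrite mulrAC divff ?mul1r.
    rewrite mulKr ?fac_neq0 // /Y addrK mulKr // fac_neq0 ?(leq_trans d0) //.
    exact: leq_trans nd dm.
  rewrite -[lz x n]divr1; apply: cvgM; last by apply: cvgV; rewrite ?oner_eq0 //; exact: cvg_fac_m.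
  apply: cvgB; last by apply: cvgM; [exact: cvg_lam | exact: cuz].
  rewrite -[X in _ --> X]divr1; apply: cvgM; last first.
    by apply: cvgV; rewrite ?oner_eq0 //; exact: cvg_fac.
  apply: cvgB; last exact: cuY.
  apply: cvgM; first exact: cvg_cst.
  case: n {IH cuz cY cuY} cz cu => [|n] cz cu /=; first exact: cvg_cst.
  by apply: cvgD; [exact: cvg_cst | exact: cz].
have czeta x : x \in xs -> z d x n @[d --> F] --> zeta x n.
  by move=> /clz c; rewrite /zeta (cvg_lim _ c).
split=> //; split=> //.
have cu' : u d n @[d --> F] --> \sum_(x <- xs) wt x * zeta x n.
  apply: cvg_trans (_ : \sum_(x <- xs) wt x * z d x n @[d --> F] --> _); last first.
    by apply: cvg_sumr => x xxs; apply: cvgM; [exact: cvg_cst | exact: czeta].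
  apply: near_eq_cvg; near=> d; symmetry.
  have : (n <= d)%N by near: d.
  near: d; apply: filterS Fd => d [_ _ _ H] nd; by have [] := H n nd.
have rE : r n = \sum_(x <- xs) wt x * zeta x n by rewrite /r (cvg_lim _ cu').
by rewrite rE.
Unshelve. all: by end_near. Qed.

Lemma resolvent_limit : exists (zt : R -> nat -> R) (ut : nat -> R),
  [/\ forall x n, x \in xs -> z d x n @[d --> F] --> zt x n,
      forall n, u d n @[d --> F] --> ut n,
      forall n, ut n = \sum_(x <- xs) wt x * zt x n &
      forall x n, x \in xs -> zt x n + lam * cconv ut (zt x) n
        + cconv ut (fun k => zt x k + lam * cconv ut (zt x) k) n
        = rt x * sshift (fun k => delta0 k + zt x k) n].
Proof.
exists zeta, r; split.
- by move=> x n xxs; have [_ [+ _]] := cvg_main n; apply.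
- by move=> n; have [_ [_ []]] := cvg_main n.
- by move=> n; have [_ [_ []]] := cvg_main n.
- move=> x n xxs; have [/(_ x xxs) c1 [/(_ x xxs) c2 _]] := cvg_main n.
  have E : zeta x n = lz x n by rewrite /zeta (cvg_lim _ c1).
  by rewrite {1}E /lz; ring.
Qed.

End LimitAlongFilter.

(** * Sums of convolution series *)

Section SeriesOfConvolutions.
Local Open Scope classical_set_scope.
Variable R : realType.
Implicit Types a b : nat -> R.

Definition abs_bounded a := exists M : R, forall N, \sum_(n < N) `|a n| <= M.

Lemma abs_bounded_cvg a : abs_bounded a -> cvgn (series a).
Proof.
move=> [M aM]; apply: normed_cvg; apply: nondecreasing_is_cvgn.
  by apply: nondecreasing_series => n _ _; apply: normr_ge0.
by exists M => _ [n _ <-]; have := aM n; rewrite -(big_mkord xpredT (fun k => `|a k|)).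
Qed.

Lemma abs_bounded_cconv a b : abs_bounded a -> abs_bounded b -> abs_bounded (cconv a b).
Proof.
move=> [M aM] [M' bM]; exists (M * M') => N.
apply: le_trans (_ : \sum_(n < N) cconv (fun i => `|a i|) (fun i => `|b i|) n <= _).
  by apply: ler_sum => n _; apply: normr_cconv.
apply: le_trans (sum_cconv_le _ _ _) _ => //.
by apply: ler_pM => //; apply: sumr_ge0.
Qed.

Lemma cvg_seriesD a b (la lb : R) : series a @ \oo --> la -> series b @ \oo --> lb ->
  series (fun n => a n + b n) @ \oo --> la + lb.
Proof.
move=> ca cb; have -> : series (fun n => a n + b n) = series a + series b.
  exact: seriesD.
exact: cvgD.
Qed.

Lemma cvg_seriesZ a (k la : R) : series a @ \oo --> la ->
  series (fun n => k * a n) @ \oo --> k * la.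
Proof.
move=> ca; have -> : series (fun n => k * a n) = (fun n => k * series a n).
  by apply/funext => n; rewrite !seriesEord /= mulr_sumr.
by apply: cvgM => //; apply: cvg_cst.
Qed.

Lemma cvg_series_sshift a (la : R) : series a @ \oo --> la ->
  series (sshift a) @ \oo --> la.
Proof.
move=> ca; rewrite -cvg_shiftS /=.
have -> : (fun n => series (sshift a) n.+1) = series a; last exact: ca.
by apply/funext => n; rewrite !seriesEord /= big_ord_recl add0r.
Qed.

Lemma cvg_series_delta0 : series (@delta0 R) @ \oo --> (1 : R).
Proof.
rewrite -cvg_shiftS /=.
have -> : (fun n => series delta0 n.+1) = (fun=> 1 : R); last exact: cvg_cst.
apply/funext => n; rewrite seriesEord /= big_ord_recl big1 ?addr0 //.
Qed.

(** The product of the partial sums differs from the partial sum of the Cauchy product by terms with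
    index between N and 2N. These are dominated by the block [D N] of the convolution of absolute
    values, which tends to 0. *)
Lemma cvg_series_cconv a b (la lb : R) : abs_bounded a -> abs_bounded b ->
  series a @ \oo --> la -> series b @ \oo --> lb ->
  series (cconv a b) @ \oo --> la * lb.
Proof.
move=> aB bB ca cb.
pose c := cconv (fun i => `|a i|) (fun i => `|b i|).
have c_ge0 n : 0 <= c n by apply: cconv_ge0.
pose D N := series c (N + N)%N - series c N.
have cC : cvgn (series c).
  apply: nondecreasing_is_cvgn.
    by apply: nondecreasing_series => n _ _.
  have [M aM] := aB; have [M' bM] := bB.
  exists (M * M') => _ [n _ <-]; rewrite seriesEord.
  apply: le_trans (sum_cconv_le _ _ _) _ => //.
  by apply: ler_pM => //; apply: sumr_ge0.
have D0 : D @ \oo --> (0 : R).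
  rewrite -(subrr (limn (series c))); apply: cvgB => //.
  apply: cvg_comp cC; apply/cvgnyPge => N; near=> n.
  by apply: leq_trans (leq_addr _ _); near: n; apply: nbhs_infty_ge.
pose E N := series a N * series b N - series (cconv a b) N.
have ED N : `|E N| <= D N.
  rewrite /E /D !seriesEord /= sum_mul_cconv !big_split_ord /=.
  have -> : \sum_(n < N) cconv a b n = \sum_(n < N) cconv (trunc N a) (trunc N b) n.
    by apply: eq_bigr => n _; rewrite cconv_trunc.
  rewrite addrAC subrr add0r [leRHS]addrAC subrr add0r.
  apply: le_trans (ler_norm_sum _ _ _) _; apply: ler_sum => n _.
  apply: le_trans (normr_cconv _ _ _) _.
  by apply: le_cconv => i _; rewrite normr_ge0 /= /trunc; case: ifP; rewrite ?normr0.
have E0 : E @ \oo --> (0 : R).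
  apply: (@squeeze_cvgr _ _ _ _ (fun n => - D n) D); last exact: D0.
    by near=> n; rewrite -ler_norml.
  by rewrite -[X in _ --> X]oppr0; apply: cvgN.
have -> : series (cconv a b) = (fun n => series a n * series b n - E n).
  by apply/funext => n; rewrite /E opprB addrC subrK.
by rewrite -[X in _ --> X]subr0; apply: cvgB => //; apply: cvgM.
Unshelve. all: by end_near. Qed.

Lemma geometric_tail (q : R) (N M : nat) : 0 <= q < 1 ->
  \sum_(N <= n < M) q ^+ n <= q ^+ N / (1 - q).
Proof.
move=> /andP[q0 q1]; have q1' : 0 < 1 - q by rewrite subr_gt0.
have [MN|NM] := leqP M N.
  by rewrite big_geq // divr_ge0 ?exprn_ge0 // ltW.
rewrite ler_pdivlMr //.
have -> : (\sum_(N <= n < M) q ^+ n) * (1 - q) = q ^+ N - q ^+ M.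
  rewrite mulr_suml; under eq_bigr do rewrite mulrBr mulr1 -exprSr.
  by rewrite -[RHS]opprB -telescope_sumr ?(ltnW NM) // -sumrN;
    under [RHS]eq_bigr do rewrite opprB.
by rewrite gerBl exprn_ge0.
Qed.

Lemma geometric_abs_bounded a (C q : R) : 0 <= q < 1 -> 0 <= C ->
  (forall n, `|a n| <= C * q ^+ n) -> forall N, \sum_(n < N) `|a n| <= C / (1 - q).
Proof.
move=> q01 C0 aC N; apply: le_trans (_ : \sum_(n < N) C * q ^+ n <= _).
  exact: ler_sum.
rewrite -mulr_sumr ler_wpM2l //; have := geometric_tail 0 N q01.
by rewrite big_mkord expr0 mul1r.
Qed.

Lemma cvg_le_series a (la M : R) : series a @ \oo --> la ->
  (forall N, \sum_(n < N) `|a n| <= M) -> `|la| <= M.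
Proof.
move=> ca aM; have nca : `|series a n| @[n --> \oo] --> `|la| by apply: cvg_norm.
rewrite -(cvg_lim _ nca) //; apply: limr_le; first by apply/cvg_ex; exists `|la|.
by apply: nearW => n; rewrite seriesEord /=; apply: le_trans (ler_norm_sum _ _ _) (aM n).
Qed.

(** Tannery's theorem with a cutoff that moves with [d]: the geometric domination is required only
    for n <= d. *)
Lemma cvg_series_dominated (F : set_system nat) {PF : ProperFilter F}
    (f : nat -> nat -> R) (l : nat -> R) (C q : R) :
  F --> \oo -> 0 <= q < 1 -> 0 <= C ->
  (forall n, f d n @[d --> F] --> l n) ->
  (\forall d \near F, forall n, (n <= d)%N -> `|f d n| <= C * q ^+ n) ->
  (forall n, `|l n| <= C * q ^+ n) ->
  \sum_(n < d.+1) f d n @[d --> F] --> limn (series l).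
Proof.
move=> Foo q01 C0 fl fC lC; have /andP[q0 q1] := q01.
have q1' : 0 < 1 - q by rewrite subr_gt0.
have cl : cvgn (series l).
  by apply: abs_bounded_cvg; exists (C / (1 - q)); apply: geometric_abs_bounded.
have cl' : \sum_(n < d.+1) l n @[d --> F] --> limn (series l).
  have h : (fun n => series l n.+1) @ \oo --> limn (series l) by rewrite cvg_shiftS.
  have -> : (fun d => \sum_(n < d.+1) l n) = (fun n => series l n.+1).
    by apply/funext => d; rewrite seriesEord.
  exact: cvg_trans (cvg_app _ Foo) h.
pose g d n := f d n - l n.
suff g0 : \sum_(n < d.+1) g d n @[d --> F] --> (0 : R).
  have -> : (fun d => \sum_(n < d.+1) f d n) =
      (fun d => \sum_(n < d.+1) g d n + \sum_(n < d.+1) l n).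
    by apply/funext => d; rewrite -big_split; apply: eq_bigr => n _; rewrite /= subrK.
  by rewrite -[X in _ --> X]add0r; apply: cvgD.
have gl n : g d n @[d --> F] --> (0 : R).
  by rewrite -(subrr (l n)); apply: cvgB; [exact: fl | exact: cvg_cst].
apply/cvgrPdist_lt => e e0.
(* [K * q ^+ N] bounds the tail from N of |f - l|, each term being at most 2 C q^n. *)
pose K := 2 * C / (1 - q).
have [N KN] : exists N, K * q ^+ N < e / 2.
  have : (K * q ^+ n) @[n --> \oo] --> K * 0.
    apply: cvgM; first exact: cvg_cst.
    by apply: cvg_expr; rewrite ger0_norm.
  rewrite mulr0 => /cvgrPdist_lt /(_ (e / 2)) [|N _ /(_ N (leqnn N))] /=.
    by rewrite divr_gt0.
  rewrite sub0r normrN => h; exists N; exact: le_lt_trans (ler_norm _) h.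
have c1 : \sum_(n < N) g d n @[d --> F] --> \sum_(n < N) (0 : R).
  by apply: cvg_sumr => n _; apply: gl.
rewrite big1 // in c1; move/cvgrPdist_lt: c1 => /(_ (e / 2)) c1.
near=> d; rewrite sub0r normrN.
have Nd : (N <= d.+1)%N.
  by near: d; apply: Foo; exists N => // n /= /leq_trans; apply.
have -> : \sum_(n < d.+1) g d n = \sum_(n < N) g d n + \sum_(N <= n < d.+1) g d n.
  by rewrite -!(big_mkord xpredT (g d)) -big_cat_nat.
rewrite (splitr e); apply: le_lt_trans (ler_normD _ _) _; apply: ltrD.
  by rewrite -normrN -sub0r; near: d; apply: c1; rewrite divr_gt0.
apply: le_lt_trans KN; apply: le_trans (ler_norm_sum _ _ _) _.
apply: le_trans (_ : \sum_(N <= n < d.+1) (2 * C) * q ^+ n <= _); last first.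
  rewrite -mulr_sumr /K -[leRHS]mulrA [_^-1 * _]mulrC.
  by rewrite ler_wpM2l ?mulr_ge0 // geometric_tail.
rewrite big_nat_cond [leRHS]big_nat_cond; apply: ler_sum => n /andP[/andP[_ nd] _].
apply: le_trans (ler_normB _ _) _; rewrite -mulrA [leRHS]mulr_natl mulr2n.
apply: lerD; last exact: lC.
have : forall n, (n <= d)%N -> `|f d n| <= C * q ^+ n by near: d.
by apply.
Unshelve. all: by end_near. Qed.

End SeriesOfConvolutions.

(** * From coefficient recursions to equations between sums *)

Section AnalyticEquation.
Local Open Scope classical_set_scope.
Variable R : realType.

(** The left side factors as (1 + U)(1 + lam U) Z, so in terms of t the equation reads Z = rho t (1
    + Z). *)
Lemma resolvent_solve (Z U s lam rho t : R) :
  1 + U != 0 -> 1 + lam * U != 0 -> t = s / ((1 + U) * (1 + lam * U)) ->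
  Z + lam * (U * Z) + U * (Z + lam * (U * Z)) = rho * (s * (1 + Z)) ->
  Z * (1 - rho * t) = rho * t.
Proof.
move=> U1 U2 tE eqZ.
have sE : s = t * ((1 + U) * (1 + lam * U)) by rewrite tE divfK // mulf_neq0.
have UU : (1 + U) * (1 + lam * U) != 0 by rewrite mulf_neq0.
apply: (mulIf UU); apply/eqP; rewrite -subr_eq0; apply/eqP.
transitivity (Z + lam * (U * Z) + U * (Z + lam * (U * Z)) - rho * (s * (1 + Z))).
  by rewrite sE; ring.
by rewrite eqZ subrr.
Qed.

(** Summation at s turns Cauchy products of absolutely summable series into products of numbers, so
    the recursion sums to one scalar equation. *)
Lemma series_resolvent (zt ut : nat -> R) (rho lam s U Z : R) :
  abs_bounded (fun n => zt n * s ^+ n) -> abs_bounded (fun n => ut n * s ^+ n) ->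
  series (fun n => ut n * s ^+ n) @ \oo --> U ->
  series (fun n => zt n * s ^+ n) @ \oo --> Z ->
  (forall n, zt n + lam * cconv ut zt n + cconv ut (fun k => zt k + lam * cconv ut zt k) n
     = rho * sshift (fun k => delta0 k + zt k) n) ->
  Z + lam * (U * Z) + U * (Z + lam * (U * Z)) = rho * (s * (1 + Z)).
Proof.
move=> zB uB cu cz rec.
pose a n := zt n * s ^+ n; pose b n := ut n * s ^+ n.
have baB := abs_bounded_cconv uB zB.
pose y n := a n + lam * cconv b a n.
have cba : series (cconv b a) @ \oo --> U * Z by apply: cvg_series_cconv.
have cy : series y @ \oo --> Z + lam * (U * Z).
  by apply: cvg_seriesD => //; apply: cvg_seriesZ.
have yB : abs_bounded y.
  have [M aM] := zB; have [M' bM] := baB; exists (M + `|lam| * M') => N.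
  apply: le_trans (_ : \sum_(n < N) (`|a n| + `|lam| * `|cconv b a n|) <= _).
    by apply: ler_sum => n _; apply: le_trans (ler_normD _ _) _; rewrite (normrM lam).
  by rewrite big_split /= lerD ?aM // -mulr_sumr ler_wpM2l // bM.
have cL : series (fun n => y n + cconv b y n) @ \oo --> Z + lam * (U * Z) + U * (Z + lam * (U * Z)).
  by apply: cvg_seriesD => //; apply: cvg_series_cconv.
have cR : series (fun n => rho * sshift (fun k => s * (delta0 k + a k)) n) @ \oo
    --> rho * (s * (1 + Z)).
  apply: cvg_seriesZ; apply: cvg_series_sshift; apply: cvg_seriesZ.
  by apply: cvg_seriesD => //; apply: cvg_series_delta0.
have E : (fun n => y n + cconv b y n) = (fun n => rho * sshift (fun k => s * (delta0 k + a k)) n).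
  apply/funext => n.
  have yE k : y k = (zt k + lam * cconv ut zt k) * s ^+ k.
    by rewrite /y mulrDl -mulrA cconv_scale.
  have -> : cconv b y n = cconv ut (fun k => zt k + lam * cconv ut zt k) n * s ^+ n.
    by rewrite cconv_scale; apply: eq_cconv => // i _; rewrite yE.
  rewrite yE -mulrDl rec -mulrA; congr (_ * _).
  case: n => [|n] /=; first by rewrite mul0r.
  rewrite exprS mulrCA mulrDl; congr (_ * (_ + _)).
  by rewrite /delta0; case: n => [|k]; rewrite ?expr0 ?mulr1 ?mul0r.
move: cL; rewrite E => cL.
exact: (cvg_unique _ cL cR).
Qed.

End AnalyticEquation.

(** * The measure and the function H *)

Section SymmetricMeasure.
Variables (R : realType) (xs : seq R) (w : R -> R).
Hypothesis uxs : uniq xs.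
Hypothesis w_gt0 : forall x, x \in xs -> 0 < w x.
Hypothesis sum_w : \sum_(x <- xs) w x = 1.
Hypothesis symm : forall x, x \in xs -> (- x) \in xs /\ w (- x) = w x.

Lemma weight01 x : x \in xs -> 0 <= w x <= 1.
Proof.
move=> xxs; rewrite ltW ?w_gt0 //= -sum_w (bigD1_seq x) //= lerDl big_seq_cond.
by apply: sumr_ge0 => y /andP[yxs _]; rewrite ltW ?w_gt0.
Qed.

Lemma sum_indicator c (g : R -> R) : c \in xs ->
  \sum_(x <- xs) (c == x)%:R * g x = g c.
Proof.
move=> cxs; rewrite (bigD1_seq c) //= eqxx mul1r big1 ?addr0 // => x /negPf xc.
by rewrite eq_sym xc mul0r.
Qed.

Lemma sum_reflect (f : R -> R) : \sum_(x <- xs) f x = \sum_(x <- xs) f (- x).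
Proof.
have p : perm_eq xs [seq - x | x <- xs].
  apply: uniq_perm => // [|x]; first by rewrite map_inj_uniq //; apply: oppr_inj.
  apply/idP/mapP => [xxs|[y yxs ->]]; last by have [] := symm yxs.
  by exists (- x); rewrite ?opprK //; have [] := symm xxs.
by rewrite (perm_big _ p) big_map.
Qed.

Section Roots.
Variable rho : seq R.
Hypothesis rho_gt0 : (0 < size rho)%N.
Hypothesis rho_ge0 : forall r, r \in rho -> 0 <= r.
Hypothesis massE : forall x, muS_mass rho x = dmass xs w x.

Let c2d_gt0 : 0 < ((2 * size rho)%:R : R)^-1.
Proof. by rewrite invr_gt0 ltr0n muln_gt0. Qed.

Lemma atom_root x : x \in xs -> x ^+ 2 \in rho.
Proof.
move=> xxs; apply: contraT => xrho; have := massE x.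
rewrite /dmass xxs /muS_mass big_seq big1 ?mulr0 => [w0|r rrho].
  by have := w_gt0 xxs; rewrite -w0 ltxx.
have nr (b : R) : b ^+ 2 = r -> (b == x) = false.
  by move=> b2; apply: contraNF xrho => /eqP <-; rewrite b2.
by rewrite !nr ?addr0 // ?sqrrN sqr_sqrtr ?rho_ge0.
Qed.

Lemma root_atom r : r \in rho -> Num.sqrt r \in xs.
Proof.
move=> rrho; apply: contraT => nxs; have := massE (Num.sqrt r).
rewrite /dmass (negPf nxs) => /eqP; rewrite gt_eqF // /muS_mass mulr_gt0 //.
rewrite (perm_big _ (perm_to_rem rrho)) big_cons eqxx.
rewrite ltr_wpDr //; last by rewrite ltr_wpDr.
by apply: sumr_ge0 => i _; rewrite addr_ge0.
Qed.

(** Each root r gives mass 1/(2d) to each of sqrt r and - sqrt r, which are atoms with the same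
    square r. *)
Lemma mean_roots (h : R -> R) :
  (size rho)%:R^-1 * \sum_(r <- rho) h r = \sum_(x <- xs) w x * h (x ^+ 2).
Proof.
transitivity (\sum_(x <- xs) \sum_(r <- rho) ((2 * size rho)%:R : R)^-1 *
   ((Num.sqrt r == x)%:R * h (x ^+ 2) + (- Num.sqrt r == x)%:R * h (x ^+ 2))); last first.
  rewrite big_seq [RHS]big_seq; apply: eq_bigr => x xxs.
  rewrite -[w x](_ : dmass xs w x = _); last by rewrite /dmass xxs.
  rewrite -massE /muS_mass -mulrA mulr_suml mulr_sumr; apply: eq_bigr => r _.
  by rewrite mulrDl.
rewrite exchange_big /= mulr_sumr big_seq [RHS]big_seq; apply: eq_bigr => r rrho.
have sr := root_atom rrho.
rewrite -mulr_sumr big_split /= !(sum_indicator (fun x => h (x ^+ 2))) //; last first.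
  by have [] := symm sr.
rewrite sqrrN sqr_sqrtr ?rho_ge0 // natrM invfM -mulr2n -mulr_natl.
have n0 : (size rho)%:R != 0 :> R by rewrite pnatr_eq0 -lt0n.
by field.
Qed.

End Roots.

(** Generating function of the even moments of mu, without the constant term. *)
Definition psi y := \sum_(x <- xs) w x * (x ^+ 2 * y / (1 - x ^+ 2 * y)).

Lemma psi_ge0 y : 0 <= y -> (forall x, x \in xs -> x ^+ 2 * y < 1) -> 0 <= psi y.
Proof.
move=> y0 xy; rewrite /psi big_seq; apply: sumr_ge0 => x xxs.
have := weight01 xxs; have := xy _ xxs => xy1 /andP[wx _].
apply: mulr_ge0 => //; apply: divr_ge0; first by rewrite mulr_ge0 ?sqr_ge0.
by rewrite subr_ge0 ltW.
Qed.

Lemma psi_le1 y : 0 <= y -> (forall x, x \in xs -> x ^+ 2 * y <= 2^-1) -> psi y <= 1.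
Proof.
move=> y0 xy; rewrite /psi -[leRHS]sum_w big_seq [leRHS]big_seq; apply: ler_sum => x xxs.
have h := xy _ xxs; apply: ler_piMr; first by rewrite ltW ?w_gt0.
by rewrite ler_pdivrMr ?mul1r; lra.
Qed.

Lemma psi_mono y t : 0 <= y -> y <= t ->
  (forall x, x \in xs -> x ^+ 2 * t < 1) -> psi y <= psi t.
Proof.
move=> y0 yt xt; rewrite /psi big_seq [leRHS]big_seq; apply: ler_sum => x xxs.
have h := xt _ xxs; have x0 : 0 <= x ^+ 2 := sqr_ge0 x.
have h' : x ^+ 2 * y <= x ^+ 2 * t by rewrite ler_wpM2l.
have h0 : 0 <= x ^+ 2 * y by rewrite mulr_ge0.
apply: ler_wpM2l; first by rewrite ltW ?w_gt0.
apply: ler_pM => //.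
  by rewrite invr_ge0; lra.
by rewrite lef_pV2 ?posrE; lra.
Qed.

(** With q = sqrt y, the transform at 1/q is q M, and averaging over x and -x gives M = 1 + psi(y).
    Then H = y M (lam M + 1 - lam). *)
Lemma Hmu_psi (lam y : R) : 0 < y -> (forall x, x \in xs -> x ^+ 2 * y < 1) ->
  Hmu lam xs w y = y * ((1 + psi y) * (1 + lam * psi y)).
Proof.
move=> y0 xy; set q := Num.sqrt y.
have q0 : 0 < q by rewrite sqrtr_gt0.
have qq : q ^+ 2 = y by rewrite sqr_sqrtr // ltW.
pose M := \sum_(x <- xs) w x / (1 - x * q).
have nz x : x \in xs -> 1 - x * q != 0 /\ 1 + x * q != 0.
  move=> /xy; rewrite -qq => h.
  have : (1 - x * q) * (1 + x * q) != 0 by rewrite gt_eqF //; nra.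
  by rewrite mulf_eq0 negb_or => /andP.
have GE : Gmu xs w q^-1 = q * M.
  rewrite /Gmu /M mulr_sumr big_seq [RHS]big_seq; apply: eq_bigr => x xxs.
  have [n1 _] := nz _ xxs; have q0' : q != 0 by rewrite gt_eqF.
  have -> : q^-1 - x = (1 - x * q) / q by field.
  by rewrite invf_div mulrCA.
have ME : M = 1 + psi y.
  have : M + M = (1 + psi y) + (1 + psi y).
    have -> : 1 + psi y = \sum_(x <- xs) (w x + w x * (x ^+ 2 * y / (1 - x ^+ 2 * y))).
      by rewrite big_split /= sum_w.
    have Mr : M = \sum_(x <- xs) w x / (1 + x * q).
      rewrite /M sum_reflect big_seq [RHS]big_seq; apply: eq_bigr => x xxs.
      by have [_ ->] := symm xxs; rewrite mulNr opprK.
    rewrite [X in _ + X]Mr /M -!big_split /=.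
    rewrite big_seq [RHS]big_seq; apply: eq_bigr => x xxs.
    have [n1 n2] := nz _ xxs; rewrite -qq.
    have n3 : 1 - x ^+ 2 * q ^+ 2 != 0.
      have -> : 1 - x ^+ 2 * q ^+ 2 = (1 - x * q) * (1 + x * q) by ring.
      by rewrite mulf_neq0.
    field; rewrite ?n1 ?n2 ?n3 /=.
    by rewrite andbT exprMn.
  lra.
rewrite /Hmu -/q GE ME -qq; ring.
Qed.

(** The discriminant is a perfect square, and [p >= 0] fixes the sign of its root. *)
Lemma Ufun_psi (lam p : R) : 0 < lam -> 0 <= p ->
  Ufun lam ((1 + p) * (1 + lam * p) - 1) = p.
Proof.
move=> l0 p0; rewrite /Ufun.
have -> : (lam + 1) ^+ 2 + 4 * lam * ((1 + p) * (1 + lam * p) - 1) = (lam + 1 + 2 * lam * p) ^+ 2.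
  by ring.
rewrite sqrtr_sqr ger0_norm; last by rewrite !addr_ge0 ?mulr_ge0 // ltW.
have l0' : lam != 0 by rewrite gt_eqF.
by field.
Qed.

(** By [Hmu_psi], H is y times nondecreasing factors that are at least 1, hence strictly
    increasing. *)
Lemma Hmu_inj (lam y t : R) : 0 < lam -> 0 < y -> 0 < t ->
  (forall x, x \in xs -> x ^+ 2 * y < 1) -> (forall x, x \in xs -> x ^+ 2 * t < 1) ->
  Hmu lam xs w y = Hmu lam xs w t -> y = t.
Proof.
move=> l0; suff mono a b : 0 < a -> a < b -> (forall x, x \in xs -> x ^+ 2 * b < 1) ->
    Hmu lam xs w a < Hmu lam xs w b.
  move=> y0 t0 xy xt E; have [yt|ty|//] := ltgtP y t.
    by have := mono _ _ y0 yt xt; rewrite E ltxx.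
  by have := mono _ _ t0 ty xy; rewrite E ltxx.
move=> a0 ab xb; have b0 := lt_trans a0 ab.
have xa x : x \in xs -> x ^+ 2 * a < 1.
  by move=> xxs; apply: le_lt_trans (xb _ xxs); rewrite ler_wpM2l ?sqr_ge0 // ltW.
rewrite !Hmu_psi //.
have pa := psi_ge0 (ltW a0) xa; have pab := psi_mono (ltW a0) (ltW ab) xb.
apply: lt_le_trans (_ : b * ((1 + psi a) * (1 + lam * psi a)) <= _).
  by rewrite ltr_pM2r // mulr_gt0 // ltr_wpDr // mulr_ge0 // ltW.
rewrite ler_pM2l //; apply: ler_pM; rewrite ?lerD2l ?ler_pM2l // addr_ge0 //.
by rewrite mulr_ge0 // ltW.
Qed.

End SymmetricMeasure.

(** * The limit theorem *)

Lemma cvg_norm_le (R : realType) (F : set_system nat) {PF : ProperFilter F}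
    (f : nat -> R) (l M : R) :
  (f @ F --> l)%classic -> (\forall d \near F, `|f d| <= M) -> `|l| <= M.
Proof.
move=> fl fM; have nfl : (`|f d| @[d --> F] --> `|l|)%classic by apply: cvg_norm.
by rewrite -(cvg_lim _ nfl) //; apply: limr_le => //; apply/cvg_ex; exists `|l|.
Qed.

Section RectangularLimit.
Local Open Scope classical_set_scope.
Variables (R : realType) (lam : R) (xs : seq R) (w : R -> R).
Variables (D : pred nat) (mD : nat -> nat) (rho : nat -> seq R).
Hypothesis lam01 : 0 < lam <= 1.
Hypothesis uxs : uniq xs.
Hypothesis w_gt0 : forall x, x \in xs -> 0 < w x.
Hypothesis sum_w : \sum_(x <- xs) w x = 1.
Hypothesis symm : forall x, x \in xs -> (- x) \in xs /\ w (- x) = w x.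
Hypothesis D_oo : forall n, exists2 d, D d & (n <= d)%N.
Hypothesis D_gt0 : forall d, D d -> (0 < d)%N.
Hypothesis mDE : forall d, D d -> (mD d)%:R = d%:R / lam.
Hypothesis rhoE : forall d, D d -> size (rho d) = d /\ (forall r, r \in rho d -> 0 <= r)
  /\ (forall x, muS_mass (rho d) x = dmass xs w x).

(** Limits along D are limits along this filter, proper because D is infinite. *)
Let F : set_system nat := within [set d | D d] \oo.

Let PF : ProperFilter F.
Proof.
split; last by apply: within_filter.
move=> [N _ H]; have [d Dd Nd] := D_oo N.
exact: (H d Nd Dd).
Qed.
Local Existing Instance PF.

Let F_oo : F --> \oo.
Proof. by move=> P [N _ H]; exists N => // d Nd _; apply: H. Qed.

Let near_D : \forall d \near F, D d.
Proof. by exists 0%N. Qed.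

Lemma near_alongP (P : nat -> Prop) : (\forall d \near F, P d) ->
  exists N, forall d, D d -> (N <= d)%N -> P d.
Proof. by move=> [N _ H]; exists N => d Dd Nd; apply: (H d Nd Dd). Qed.

Let l0 : 0 < lam. Proof. by case/andP: lam01. Qed.

Let mD_ge d : D d -> (d <= mD d)%N.
Proof.
move=> Dd; rewrite -(ler_nat R) mDE // ler_pdivlMr // ler_piMr //.
by case/andP: lam01.
Qed.

Let mD_lam d : D d -> (mD d)%:R^-1 * d%:R = lam.
Proof.
move=> Dd; have d0 : d%:R != 0 :> R by rewrite pnatr_eq0 -lt0n D_gt0.
by rewrite mDE // invf_div divfK.
Qed.

Let z d x := resolvent_seq (mD d) (rho d) (x ^+ 2).
Let u d := finR_seq (mD d) (rho d).

Let uE d n : D d -> (n <= d)%N -> u d n = \sum_(x <- xs) w x * z d x n.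
Proof.
move=> Dd nd; have [sd [r0 mE]] := rhoE Dd.
rewrite /u finR_seqE ?sd //.
rewrite -(mean_roots uxs symm _ r0 mE (fun r => resolvent_seq (mD d) (rho d) r n)) ?sd //.
exact: D_gt0.
Qed.

Let zrec d x n : D d -> x \in xs -> (n <= d)%N ->
  let Y k := (1 - (k%:R - 1) * (mD d)%:R^-1) * z d x k
             + (mD d)%:R^-1 * d%:R * cconv (u d) (z d x) k in
  (1 - (n%:R - 1) * d%:R^-1) * Y n + cconv (u d) Y n =
  x ^+ 2 * sshift (fun k => delta0 k + z d x k) n.
Proof.
move=> Dd xxs nd; have [sd [r0 mE]] := rhoE Dd.
have sz : (0 < size (rho d))%N by rewrite sd D_gt0.
have sm : (size (rho d) <= mD d)%N by rewrite sd mD_ge.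
have xr := atom_root w_gt0 r0 mE xxs.
have nd' : (n <= size (rho d))%N by rewrite sd.
by have := resolvent_recursion sm sz xr nd'; rewrite sd.
Qed.

Let A : R := 1 + \sum_(x <- xs) x ^+ 2.
(** Common growth rate: e^2 comes from the weights, the rest from [cubic_growth]. *)
Let K : R := expR 1 ^+ 2 * (16 * (A * (size xs).+1%:R)).

Let A_ge1 : 1 <= A.
Proof. by rewrite /A lerDl sumr_ge0 // => x _; apply: sqr_ge0. Qed.

Let sqr_le_A x : x \in xs -> x ^+ 2 <= A.
Proof.
move=> xxs; rewrite /A (bigD1_seq x) //= addrCA lerDl addr_ge0 // sumr_ge0 // => y _.
exact: sqr_ge0.
Qed.

Let K_ge : 16 * A <= K.
Proof.
have A0 : 0 <= A := le_trans ler01 A_ge1.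
have e1 : 1 <= expR 1 :> R by rewrite -expR0 ler_expR.
have e2 : 1 <= expR 1 ^+ 2 :> R by rewrite exprn_ege1.
apply: le_trans (_ : 16 * (A * (size xs).+1%:R) <= _).
  by rewrite ler_pM2l // ler_peMr // ler1n.
by rewrite /K ler_peMl // !mulr_ge0.
Qed.

Let K_gt0 : 0 < K.
Proof. by apply: lt_le_trans K_ge; rewrite mulr_gt0 // (lt_le_trans ltr01). Qed.

Let z_bound d n : D d -> (n <= d)%N -> \sum_(x <- xs) `|z d x n| <= 8^-1 * K ^+ n.
Proof.
move=> Dd; apply: (resolvent_growth (D_gt0 Dd) (mD_ge Dd) (rt := fun x => x ^+ 2)
   (wt := w) (u := u d)).
- exact: lt_le_trans ltr01 A_ge1.
- by move=> x xxs; rewrite sqr_ge0 sqr_le_A.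
- by move=> x xxs; apply: (weight01 uxs w_gt0 sum_w xxs).
- by move=> x; apply: resolvent_seq0.
- by move=> k kd; apply: uE.
- by move=> x k xxs kd; apply: zrec.
Qed.

Let z_bound1 d x n : D d -> x \in xs -> (n <= d)%N -> `|z d x n| <= 8^-1 * K ^+ n.
Proof.
move=> Dd xxs nd; apply: le_trans (z_bound Dd nd); rewrite (bigD1_seq x) //= lerDl.
exact: sumr_ge0.
Qed.

Let u_bound d n : D d -> (n <= d)%N -> `|u d n| <= 8^-1 * K ^+ n.
Proof.
move=> Dd nd; apply: le_trans (z_bound Dd nd); rewrite uE //.
apply: le_trans (ler_norm_sum _ _ _) _; rewrite big_seq [leRHS]big_seq.
apply: ler_sum => x xxs; have /andP[? ?] := weight01 uxs w_gt0 sum_w xxs.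
by rewrite normrM ger0_norm // ler_piMl.
Qed.

Lemma finR_limit : exists (zt : R -> nat -> R) (r : nat -> R),
  [/\ forall n, u d n @[d --> F] --> r n,
      forall n, `|r n| <= 8^-1 * K ^+ n,
      forall x n, x \in xs -> `|zt x n| <= 8^-1 * K ^+ n,
      forall n, r n = \sum_(x <- xs) w x * zt x n &
      forall x n, x \in xs -> zt x n + lam * cconv r (zt x) n
        + cconv r (fun k => zt x k + lam * cconv r (zt x) k) n
        = x ^+ 2 * sshift (fun k => delta0 k + zt x k) n].
Proof.
have [] := @resolvent_limit R F PF xs w (fun x => x ^+ 2) lam mD z u F_oo.
- by move=> d x; apply: resolvent_seq0.
- by move=> d; apply: finR_seq0.
- apply: filterS near_D => d Dd; split; [exact: D_gt0 | exact: mD_ge | exact: mD_lam |].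
  by move=> n nd; split=> [|x xxs]; [apply: uE | apply: zrec].
move=> zt [r [cz cu rE eqz]]; exists zt, r; split=> // [n|x n xxs].
  apply: (cvg_norm_le (cu n)); near=> d.
  by apply: u_bound; [near: d | near: d; apply: F_oo; apply: nbhs_infty_ge].
apply: (cvg_norm_le (cz x n xxs)); near=> d.
by apply: z_bound1 => //; [near: d | near: d; apply: F_oo; apply: nbhs_infty_ge].
Unshelve. all: by end_near. Qed.

(** Half the guaranteed radius 1/K: then K|s| < 1/2, and all the series have absolute sum at most
    (1/8)/(1 - 1/2) = 1/4, which keeps 1 + U and 1 + lam U away from 0. *)
Let delta : R := (2 * K)^-1.

Let delta_gt0 : 0 < delta. Proof. by rewrite invr_gt0 mulr_gt0. Qed.

Let radius (s : R) : `|s| < delta -> 0 <= (K * `|s| : R) < 2^-1.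
Proof.
move=> sd; rewrite mulr_ge0 ?(ltW K_gt0) //=.
by rewrite -ltr_pdivlMl // -invfM [K * 2]mulrC.
Qed.

Let geo (a : nat -> R) (s : R) : (forall n, `|a n| <= 8^-1 * K ^+ n) ->
  forall n, `|a n * s ^+ n| <= 8^-1 * (K * `|s|) ^+ n.
Proof.
by move=> aK n; rewrite normrM normrX exprMn mulrA ler_wpM2r // exprn_ge0.
Qed.

Let geo_sum (a : nat -> R) (s : R) : `|s| < delta -> (forall n, `|a n| <= 8^-1 * K ^+ n) ->
  forall N, \sum_(n < N) `|a n * s ^+ n| <= 4^-1.
Proof.
move=> sd aK N; have /andP[q0 q2] := radius sd.
apply: le_trans (geometric_abs_bounded _ _ (geo _ aK) N) _ => //.
  by rewrite q0 /=; lra.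
by rewrite ler_pdivrMr; lra.
Qed.

Let geo_bounded (a : nat -> R) (s : R) : `|s| < delta -> (forall n, `|a n| <= 8^-1 * K ^+ n) ->
  abs_bounded (fun n => a n * s ^+ n).
Proof. by move=> sd aK; exists 4^-1; apply: geo_sum. Qed.

Lemma rect_limit_functional_equation (zt : R -> nat -> R) (r : nat -> R) (y : R) :
  (forall n, `|r n| <= 8^-1 * K ^+ n) ->
  (forall x n, x \in xs -> `|zt x n| <= 8^-1 * K ^+ n) ->
  (forall n, r n = \sum_(x <- xs) w x * zt x n) ->
  (forall x n, x \in xs -> zt x n + lam * cconv r (zt x) n
        + cconv r (fun k => zt x k + lam * cconv r (zt x) k) n
        = x ^+ 2 * sshift (fun k => delta0 k + zt x k) n) ->
  0 < y < delta / 4 ->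
  `|Hmu lam xs w y| < delta /\
  limn (series (fun k => r k * (Hmu lam xs w y) ^+ k)) = Ufun lam (Hmu lam xs w y / y - 1).
Proof.
move=> rK zK rE eqz /andP[y0 yd]; have A0 : 0 < A := lt_le_trans ltr01 A_ge1.
(* From 16 A <= K. Hence x^2 t <= 1/16 for every atom and every t up to 2 delta, within the domain
   of [psi]. *)
have Ad : A * delta <= 32^-1.
  by rewrite /delta ler_pdivrMr ?mulr_gt0 //; have := K_ge; lra.
have small t x : 0 <= t -> t <= 2 * delta -> x \in xs -> x ^+ 2 * t <= 2^-1.
  move=> t0 td xxs; apply: le_trans (_ : A * (2 * delta) <= _).
    by apply: ler_pM; rewrite ?sqr_ge0 ?sqr_le_A.
  by rewrite mulrCA; lra.
have small1 t x : 0 <= t -> t <= 2 * delta -> x \in xs -> x ^+ 2 * t < 1.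
  by move=> t0 td xxs; have := small _ _ t0 td xxs; lra.
have yd2 : y <= 2 * delta by have := delta_gt0; lra.
have xy x := small1 y x (ltW y0) yd2.
have p0 : 0 <= psi xs w y by apply: psi_ge0 => //; exact: ltW.
have p1 : psi xs w y <= 1.
  by apply: psi_le1 => // [|x]; [exact: ltW | apply: small => //; exact: ltW].
have HE := Hmu_psi uxs sum_w symm lam y0 xy.
set s := Hmu lam xs w y in HE *; set p := psi xs w y in p0 p1 HE.
have /andP[_ l1] := lam01.
have lp0 : 0 <= lam * p by rewrite mulr_ge0 // ltW.
have lp1 : lam * p <= 1 by rewrite mulr_ile1 // ltW.
have pp : 1 <= (1 + p) * (1 + lam * p) <= 4 by apply/andP; split; nra.
have /andP[pp1 pp4] := pp.
have s0 : 0 < s by rewrite HE mulr_gt0 // (lt_le_trans ltr01).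
(* Both psi(y) and lam psi(y) are at most 1, so H(y) <= 4 y; this is why y is kept below delta /
   4. *)
have sd : s < delta.
  by apply: le_lt_trans (_ : y * 4 < _); [rewrite HE ler_pM2l | lra].
have sd' : `|s| < delta by rewrite gtr0_norm.
split=> //.
pose U : R := limn (series (fun k => r k * s ^+ k)).
pose Z x : R := limn (series (fun k => zt x k * s ^+ k)).
have rB := geo_bounded sd' rK.
have cU : series (fun k => r k * s ^+ k) @ \oo --> U by apply: abs_bounded_cvg.
have zB x xxs := geo_bounded sd' (fun n => zK x n xxs).
have cZ x : x \in xs -> series (fun k => zt x k * s ^+ k) @ \oo --> Z x.
  by move=> xxs; apply: abs_bounded_cvg; apply: zB.
have U4 : `|U| <= 4^-1 by apply: cvg_le_series cU (geo_sum sd' rK).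
have [U4l U4r] : - 4^-1 <= U /\ U <= 4^-1 by apply/andP; rewrite -ler_norml.
have UZ : U = \sum_(x <- xs) w x * Z x.
  have c : \sum_(x <- xs) w x * series (fun k => zt x k * s ^+ k) N @[N --> \oo]
      --> \sum_(x <- xs) w x * Z x.
    by apply: cvg_sumr => x xxs; apply: cvgM; [exact: cvg_cst | exact: cZ].
  rewrite -(cvg_lim _ c) //; congr (limn _); apply/funext => N.
  rewrite seriesEord /=.
  under [RHS]eq_bigr do rewrite seriesEord /= mulr_sumr.
  rewrite exchange_big; apply: eq_bigr => i _; rewrite rE mulr_suml.
  by apply: eq_bigr => x _; rewrite mulrA.
have lU : - 4^-1 <= lam * U <= 4^-1.
  by rewrite -ler_norml normrM gtr0_norm // -[leRHS]mul1r ler_pM // ltW.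
have /andP[lU1 lU2] := lU.
have U1 : 0 < 1 + U by lra.
have U2 : 0 < 1 + lam * U by lra.
(* The candidate preimage of s under H, built from the sum U of the series. The denominator is at
   least (3/4)^2 > 1/2, so t <= 2 delta. *)
pose t := s / ((1 + U) * (1 + lam * U)).
have t0 : 0 < t by rewrite divr_gt0 // mulr_gt0.
have t2 : t <= 2 * delta.
  apply: le_trans (_ : s * 2 <= _); last by lra.
  rewrite ler_pM2l // invf_ple ?posrE ?mulr_gt0 //; nra.
have ZE x : x \in xs -> Z x = x ^+ 2 * t / (1 - x ^+ 2 * t).
  move=> xxs; have t1 := small1 t x (ltW t0) t2 xxs.
  have nz : 1 - x ^+ 2 * t != 0 by rewrite gt_eqF // subr_gt0.
  apply: (mulIf nz); rewrite divfK //.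
  apply: (@resolvent_solve _ _ U s lam) => //; rewrite ?gt_eqF //.
  by apply: (@series_resolvent _ (zt x) r) => //; [exact: zB | exact: cZ | move=> n; apply: eqz].
have UE : U = psi xs w t.
  by rewrite UZ /psi big_seq [RHS]big_seq; apply: eq_bigr => x xxs; rewrite ZE.
have xt x := small1 t x (ltW t0) t2.
have sE : s = Hmu lam xs w t.
  rewrite (Hmu_psi uxs sum_w symm lam t0 xt) -UE /t divfK //.
  by rewrite mulf_neq0 // gt_eqF.
have yt : y = t by apply: (Hmu_inj uxs w_gt0 sum_w symm l0 y0 t0 xy xt).
rewrite -/U UE -yt -/p HE [y * _]mulrC mulfK ?gt_eqF //.
by rewrite Ufun_psi.
Qed.

(** The second clause pins down [r]: H(y) is positive and tends to 0 with y, and a convergent power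
    series is determined by its values at such points. *)
Lemma rect_limit : exists (delta eta : R) (r : nat -> R),
    0 < delta /\ 0 < eta /\
    [/\
      (forall s : R, `|s| < delta -> cvgn (series (fun k : nat => (r k * s ^+ k : R)) : R^nat)),
      (forall y, 0 < y < eta ->
         `|Hmu lam xs w y| < delta /\
         limn (series (fun k => r k * (Hmu lam xs w y) ^+ k))
           = Ufun lam (Hmu lam xs w y / y - 1)),
      (forall (k : nat) (eps : R), 0 < eps -> exists N, forall d, D d -> (N <= d)%N ->
         `|(finR (mD d) (rho d))`_k - r k| < eps)
    & (forall s : R, `|s| < delta -> forall eps : R, 0 < eps ->
         exists N, forall d, D d -> (N <= d)%N ->
         `|(finR (mD d) (rho d)).[s] - limn (series (fun k : nat => (r k * s ^+ k : R)) : R^nat)| < eps)].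
Proof.
have [zt [r [cu rK zK rE eqz]]] := finR_limit.
exists delta, (delta / 4), r; split; first exact: delta_gt0.
split; first by rewrite divr_gt0 // delta_gt0.
split.
- by move=> s sd; apply: abs_bounded_cvg; apply: geo_bounded.
- by move=> y; apply: (rect_limit_functional_equation rK zK rE eqz).
- move=> k eps e0; apply: near_alongP; near=> d.
  have Dd : D d by near: d.
  have kd : (k <= d)%N by near: d; apply: F_oo; apply: nbhs_infty_ge.
  have [sd _] := rhoE Dd; rewrite coef_finR ?sd // distrC -/(u d) .
  by near: d; move/cvgrPdist_lt: (cu k); apply.
- move=> s sd eps e0; apply: near_alongP.
  have /andP[q0 q2] := radius sd.
  have c : \sum_(n < d.+1) u d n * s ^+ n @[d --> F] -->
      limn (series (fun k : nat => (r k * s ^+ k : R))).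
    apply: (@cvg_series_dominated _ F PF (fun d n => u d n * s ^+ n) _ 8^-1 (K * `|s|)) => //.
    + by rewrite q0 /=; lra.
    + by move=> n; apply: cvgM; [exact: cu | exact: cvg_cst].
    + near=> d => n nd; rewrite normrM normrX exprMn mulrA ler_wpM2r ?exprn_ge0 //.
      by apply: u_bound => //; near: d.
    + exact: geo.
  near=> d.
  have Dd : D d by near: d.
  have [szd _] := rhoE Dd.
  have -> : (finR (mD d) (rho d)).[s] = \sum_(n < d.+1) u d n * s ^+ n.
    (* [finR] has degree at most d, so its value is exactly the partial sum with d+1 terms to which
       dominated convergence applies. *)
    rewrite (@horner_coef_wide _ d.+1); last first.
      by apply: leq_trans (size_poly _ _) _; rewrite szd.
    by apply: eq_bigr => n _; rewrite coef_finR // szd -ltnS.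
  by rewrite distrC; near: d; move/cvgrPdist_lt: c; apply.
Unshelve. all: by end_near. Qed.

End RectangularLimit.

Theorem mainTheorem2 (R : realType) (lam : R) (xs : seq R) (w : R -> R)
    (D : pred nat) (mD : nat -> nat) (rho : nat -> seq R) :
  0 < lam <= 1 ->
  (* mu = sum_{x in xs} w x delta_x : symmetric finitely supported probability *)
  uniq xs -> (forall x, x \in xs -> 0 < w x) -> \sum_(x <- xs) w x = 1 ->
  (forall x, x \in xs -> (- x) \in xs /\ w (- x) = w x) ->
  (* D infinite set of positive integers *)
  (forall n, exists2 d, D d & (n <= d)%N) ->
  (forall d, D d -> (0 < d)%N) ->
  (* m = d / lambda is an integer *)
  (forall d, D d -> (mD d)%:R = d%:R / lam) ->
  (* p_d = prod (X - rho_i), rho_i >= 0, degree d, mu_{S p_d} = mu *)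
  (forall d, D d ->
     size (rho d) = d /\ (forall r, r \in rho d -> 0 <= r)
       /\ (forall x, muS_mass (rho d) x = dmass xs w x)) ->
  exists (delta eta : R) (r : nat -> R),
    0 < delta /\ 0 < eta /\
    [/\
      (* sum_k r k s^k converges on (-delta, delta): this is R^lambda_mu *)
      (forall s : R, `|s| < delta -> cvgn (series (fun k : nat => (r k * s ^+ k : R)) : R^nat)),
      (* R^lambda_mu(H(y)) = U^lambda(H(y)/y - 1), i.e. R(x) = U(x/H^{-1}(x) - 1) *)
      (forall y, 0 < y < eta ->
         `|Hmu lam xs w y| < delta /\
         limn (series (fun k => r k * (Hmu lam xs w y) ^+ k))
           = Ufun lam (Hmu lam xs w y / y - 1)),
      (* coefficientwise convergence along D *)
      (forall (k : nat) (eps : R), 0 < eps -> exists N, forall d, D d -> (N <= d)%N ->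
         `|(finR (mD d) (rho d))`_k - r k| < eps)
    & (* pointwise convergence for |s| < delta *)
      (forall s : R, `|s| < delta -> forall eps : R, 0 < eps ->
         exists N, forall d, D d -> (N <= d)%N ->
         `|(finR (mD d) (rho d)).[s] - limn (series (fun k : nat => (r k * s ^+ k : R)) : R^nat)| < eps)].
Proof. by move=> *; apply: rect_limit. Qed.
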